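(* Let $\alpha>2\pi/5$ and let $G$ be an $\alpha$AC graph with $n$ vertices. Then $G$ has at most $6n-12$ edges.
   Context: A geometric graph is a graph whose vertices are distinct points in $\mathbb{R}^2$ and whose edges are straight-line segments joining their endpoints. Two edges cross if the segments intersect at a point other than a common endpoint; the crossing angle is the smaller angle between the two segments. For $\beta>0$, a geometric graph is a $\beta$ angle crossing ($\beta$AC) graph if every pair of crossing edges crosses at an angle of at least $\beta$.
   Formalization: The claim is stated for n ≥ 3 vertices only; as written it fails for smaller n (with n = 2 and a single edge, 1 > 6·2−12 = 0, and for n = 0, 1 the bound is negative). *)

(* Defs.v *)
From mathcomp Require Import all_boot all_order all_algebra.
From mathcomp Require Import boolp classical_sets reals trigo.

Set Implicit Arguments.
Unset Strict Implicit.
Unset Printing Implicit Defensive.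

Import Order.TTheory GRing.Theory Num.Theory.

Local Open Scope ring_scope.

Section Plane.
Context {R : realType}.
Implicit Types (a b c d u v : 'rV[R]_2).

Definition segment a b : set 'rV[R]_2 :=
  fun q => exists t : R, 0 <= t <= 1 /\ q = (1 - t) *: a + t *: b.

Definition dot u v : R := \sum_(i < 2) u 0 i * v 0 i.

(* The library norm `|u| on row vectors is the sup norm, not this one. *)
Definition enorm u : R := Num.sqrt (dot u u).

Definition vangle u v : R := acos (dot u v / (enorm u * enorm v)).

(* Meeting segments form the angles t and pi - t, where t is the angle between
   their direction vectors; the result does not depend on the orientations. *)
Definition segment_angle a b c d : R :=
  let t := vangle (b - a) (d - c) in Num.min t (pi - t).

End Plane.

Record geometric_graph (R : realType) := GeometricGraph {
  vertex : finType;
  adj : rel vertex;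
  adj_sym : symmetric adj;
  adj_irrefl : irreflexive adj;
  pos : vertex -> 'rV[R]_2;
  pos_inj : injective pos
}.

Section GeometricGraph.
Context {R : realType} (G : geometric_graph R).
Implicit Types x y z w : vertex G.

Definition edges : {set {set vertex G}} :=
  [set [set p.1; p.2]%SET | p : vertex G * vertex G & adj p.1 p.2]%SET.

(* The edges xy and zw cross.  A vertex lying in the interior of an edge is
   allowed, and that edge then crosses every edge incident to the vertex;
   likewise two distinct edges that overlap cross. *)
Definition crossing x y z w : Prop :=
  [/\ adj x y, adj z w, [set x; y]%SET != [set z; w]%SET &
    exists q : 'rV[R]_2,
      [/\ segment (pos x) (pos y) q, segment (pos z) (pos w) q &
        ~ exists v : vertex G,
            v \in ([set x; y] :&: [set z; w])%SET /\ q = pos v]].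

Definition angle_crossing (beta : R) : Prop :=
  forall x y z w, crossing x y z w ->
    beta <= segment_angle (pos x) (pos y) (pos z) (pos w).

End GeometricGraph.

(* Main.v *)
(* The drawing is planarized: its points are the vertices and the crossings, its edges
   the pieces of the original edges.  Three edges cannot cross at one point, so every
   crossing has degree 4.  Give each face f, with |f| sides and v(f) corners at
   vertices, the charge |f| + v(f) - 4; by Euler's formula the total is at most 4n - 8.
   Since angles exceed 2 pi / 5, no face has only crossings for corners and three or
   five sides, for the turning angle along it would lie strictly between consecutive
   multiples of pi.  A triangle with a single vertex has charge 0 and gets 1/3 through
   its opposite side, the request being passed on across quadrilaterals with only
   crossings for corners; it cannot end at another such triangle, because two lines
   meet at most once.  Then every face keeps charge at least v(f) / 3, and as each edge
   end contributes a corner, 2|E| / 3 <= 4n - 8.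

   Faces are the cycles of a permutation of the darts (p, q).  Euler's inequality is
   proved by completing the graph to a maximal plane one, whose convex corners all
   belong to triangles, counting how often a fixed direction and its opposite lie in
   the corners, and deleting the added edges one at a time.  Isolated edges, which
   violate the face bound, are removed beforehand. *)

Require Import Defs.
(* Loaded before all_boot so that the names shared with finset and fintype,
   such as subsetP, refer to the latter. *)
From mathcomp Require Import boolp classical_sets.
From mathcomp Require Import all_boot all_order all_fingroup all_algebra.
From mathcomp Require Import reals trigo.
From mathcomp Require Import ring lra zify.
Set Implicit Arguments.
Unset Strict Implicit.
Unset Printing Implicit Defensive.
Import Order.TTheory GRing.Theory Num.Theory.
Local Open Scope ring_scope.

(** * Angular order of plane vectors *)

(** Faces are combinatorial boundary walks, so neither regions of the plane nor the Jordan curve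
    theorem occur. A disconnected drawing has a separate walk for every boundary component; vertices
    minus edges plus walks is then twice the number of components, so the inequality with 2 survives
    and connectivity is never discussed. The constant 2 pi / 5 comes from pentagons: five turns in
    [alpha, pi - alpha] are sure to add up to strictly between 2 pi and 3 pi only if alpha > 2 pi /
    5. For triangles, and to exclude three edges through one point, alpha > pi / 3 is enough. Angles
    are measured only in this summation and where the hypothesis is translated. Elsewhere the
    hypothesis has the polynomial form [wide]: the squared cosine between two lines is at most
    [cos alpha ^+ 2]. *)

Section PlaneVectors.
Variable R : realFieldType.
Implicit Types (u v w : R * R).

Definition cross u v : R := u.1 * v.2 - u.2 * v.1.
Definition dotp u v : R := u.1 * v.1 + u.2 * v.2.
Definition vec (a b : R * R) : R * R := (b.1 - a.1, b.2 - a.2).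
Definition oppv u : R * R := (- u.1, - u.2).
Definition nzv u := (u.1 != 0) || (u.2 != 0).
(** A half-open half plane: it holds exactly one of [u] and [oppv u] for every nonzero [u], vertical
    ones included. Applied to differences it is the lexicographic order of points. *)
Definition lexpos u := (0 < u.1) || ((u.1 == 0) && (0 < u.2)).

(* Directions are ordered by their angle in ]-pi/2, 3pi/2]. *)
Definition alt u v :=
  (lexpos u && ~~ lexpos v) || ((lexpos u == lexpos v) && (0 < cross u v)).

Lemma lexposP u : reflect (0 < u.1 \/ u.1 = 0 /\ 0 < u.2) (lexpos u).
Proof.
rewrite /lexpos; apply: (iffP orP) => -[]; first by left.
- by case/andP=> /eqP; right.
- by left.
- by case=> -> ->; right; rewrite eqxx.
Qed.

Lemma oppvK u : oppv (oppv u) = u.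
Proof. by case: u => x y; rewrite /oppv /= !opprK. Qed.

Lemma lexposN u : nzv u -> lexpos (oppv u) = ~~ lexpos u.
Proof.
rewrite /nzv /lexpos /= !oppr_gt0 oppr_eq0.
by case: (ltgtP u.1 0) => //= _; case: (ltgtP u.2 0).
Qed.

Lemma crossNN u v : cross (oppv u) (oppv v) = cross u v.
Proof. by rewrite /cross /=; ring. Qed.
Lemma crossNl u v : cross (oppv u) v = - cross u v.
Proof. by rewrite /cross /=; ring. Qed.
Lemma crossNr u v : cross u (oppv v) = - cross u v.
Proof. by rewrite /cross /=; ring. Qed.
Lemma crossC u v : cross u v = - cross v u.
Proof. by rewrite /cross; ring. Qed.
Lemma crossxx u : cross u u = 0.
Proof. by rewrite /cross; ring. Qed.

Lemma cross_lexpos_trans u v w : lexpos u -> lexpos v -> lexpos w ->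
  0 < cross u v -> 0 < cross v w -> 0 < cross u w.
Proof.
case: u v w => [u1 u2] [v1 v2] [w1 w2]; rewrite /cross /=.
move=> /lexposP /= Hu /lexposP /= Hv /lexposP /= Hw c1 c2.
(* The Plücker relation of three plane vectors; in the half plane its coefficients [u1] and [w1] are
   nonnegative. *)
have E : v1 * (u1 * w2 - u2 * w1) = u1 * (v1 * w2 - v2 * w1) + w1 * (u1 * v2 - u2 * v1) by ring.
case: Hv => [v1p | [v1z v2p]]; last first.
  subst v1; have w1n : w1 < 0 by nra.
  by case: Hw => [|[]]; lra.
rewrite -(pmulr_rgt0 _ v1p) E.
case: Hu => [u1p | [u1z u2p]]; case: Hw => [w1p | [w1z w2p]]; subst; nra.
Qed.

Lemma cross_lexpos_trans_le u v w : lexpos u -> lexpos v -> lexpos w ->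
  0 <= cross u v -> 0 <= cross v w -> 0 <= cross u w.
Proof.
case: u v w => [u1 u2] [v1 v2] [w1 w2]; rewrite /cross /=.
move=> /lexposP /= Hu /lexposP /= Hv /lexposP /= Hw c1 c2.
have E : v1 * (u1 * w2 - u2 * w1) = u1 * (v1 * w2 - v2 * w1) + w1 * (u1 * v2 - u2 * v1) by ring.
have u1p : 0 <= u1 by case: Hu => [|[]]; lra.
have w1p : 0 <= w1 by case: Hw => [|[]]; lra.
case: Hv => [v1p | [v1z v2p]]; last first.
  subst v1; have w1n : w1 = 0 by nra.
  by subst; case: Hw => [|[_ ?]]; nra.
rewrite -(pmulr_rge0 _ v1p) E; nra.
Qed.

Lemma alt_same u v : lexpos u = lexpos v -> alt u v = (0 < cross u v).
Proof. by rewrite /alt => ->; rewrite andbN eqxx. Qed.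

Definition sdir u v := (lexpos u == lexpos v) && (cross u v == 0).

Lemma alt_total u v : nzv u -> nzv v -> [|| alt u v, alt v u | sdir u v].
Proof.
move=> nu nv; rewrite /alt /sdir (eq_sym (lexpos v)) [cross v u]crossC oppr_gt0.
by case: (lexpos u); case: (lexpos v) => //=; case: ltgtP.
Qed.

Lemma nalt_trans u v w : nzv u -> nzv v -> nzv w ->
  ~~ alt v u -> ~~ alt w v -> ~~ alt w u.
Proof.
move=> nu nv nw; rewrite /alt.
case Lu: (lexpos u); case Lv: (lexpos v); case Lw: (lexpos w) => //=;
  rewrite -!leNgt ![cross v u]crossC ![cross w _]crossC !oppr_le0 => c1 c2 //;
  do ?[by apply: cross_lexpos_trans_le c1 c2].
rewrite -crossNN; apply: (@cross_lexpos_trans_le _ (oppv v)); rewrite ?crossNN //;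
  by rewrite lexposN ?Lu ?Lv ?Lw.
Qed.

Lemma alt_asym u v : alt u v -> alt v u = false.
Proof.
rewrite /alt [cross v u]crossC oppr_gt0.
by case: (lexpos u); case: (lexpos v) => //=; case: ltgtP.
Qed.

(* Cyclic order: going counterclockwise from u one meets v strictly before w. *)
Definition ccw3 u v w :=
  [|| alt u v && alt v w, alt v w && alt w u | alt w u && alt u v].

(** In a sector narrower than a half turn the cyclic order is decided by two signs. This turns facts
    about [next] in a sorted list into orientation inequalities. *)
Lemma ccw3_sector u v w : nzv u -> nzv v -> nzv w ->
  0 < cross u w -> ccw3 u v w = (0 < cross u v) && (0 < cross v w).
Proof.
move=> nu nv nw cuw.
have cwu : (0 < cross w u) = false by rewrite crossC oppr_gt0; apply: lt_gtF.
have Nu := lexposN nu; have Nv := lexposN nv; have Nw := lexposN nw.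
rewrite /ccw3 /alt cwu.
case Lu: (lexpos u) Nu; case Lv: (lexpos v) Nv; case Lw: (lexpos w) Nw => /= Nw Nv Nu;
  rewrite ?andbF ?orbF ?andbT //.
- rewrite andb_idr // => c; rewrite -[cross v w]opprK -crossNr oppr_gt0 crossC oppr_lt0.
  by apply: (cross_lexpos_trans _ Lu) => //; rewrite // crossNl crossC opprK.
- apply/esym/negP => /andP[c1 c2]; move/negP: cwu; apply.
  apply: (cross_lexpos_trans _ Nv) => //; last by rewrite crossNl crossC opprK.
  by rewrite crossNr crossC opprK.
- rewrite andb_idl // => c; rewrite crossC -crossNl.
  by apply: (cross_lexpos_trans _ Nw) => //; rewrite ?crossNN // crossNl crossC opprK.
- rewrite andb_idl // => c; rewrite crossC -crossNr.
  by apply: (cross_lexpos_trans _ Lw) => //; rewrite crossNr crossC opprK.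
- apply/esym/negP => /andP[c1 c2]; move/negP: cwu; apply.
  rewrite -crossNN; apply: (cross_lexpos_trans _ Lv) => //.
    by rewrite crossNl crossC opprK.
  by rewrite crossNr crossC opprK.
- rewrite andb_idr // => c; rewrite crossC -crossNr.
  by apply: (cross_lexpos_trans _ Nu) => //; rewrite ?crossNN // crossNr crossC opprK.
Qed.

End PlaneVectors.

(** * Cyclic sequences and cycles of permutations *)

Section CyclicSequences.
Variable T : eqType.
Implicit Types (s : seq T) (x y z : T).

Lemma index_next s y : uniq s -> y \in s ->
  index (next s y) s = if (index y s).+1 == size s then 0%N else (index y s).+1.
Proof.
move=> us ys; rewrite next_nth ys; case: s us ys => // a s us ys.
have := ys; rewrite -index_mem [size _]/= eqSS ltnS.
move: (index y (a :: s)) => i le.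
case: eqP => [->|/eqP ne]; first by rewrite nth_default //= eqxx.
have lt : (i < size s)%N by rewrite ltn_neqAle ne le.
by rewrite (_ : nth a s i = nth a (a :: s) i.+1) // index_uniq.
Qed.

(** Models the removal of a neighbour from the rotation at a point: only the predecessor of [q] gets
    a new successor. *)
Lemma next_filter s q y : uniq s -> q \in s -> y \in s -> y != q ->
  next [seq z <- s | z != q] y = if next s y == q then next s q else next s y.
Proof.
move=> us qs ys yq; have [i s' E] := rot_to qs.
have us' : uniq (q :: s') by rewrite -E rot_uniq.
have ys' : y \in s' by move: ys; rewrite -(mem_rot i) E inE (negbTE yq).
have F : [seq z <- q :: s' | z != q] = s'.
  rewrite /= eqxx /=; apply/all_filterP/allP => z zs; apply/negP => /eqP zq.
  by move: us'; rewrite /= -zq zs.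
have [j Ej] : exists j, rot j [seq z <- s | z != q] = s'.
  exists (count (fun z => z != q) (take i s)).
  rewrite -F -E /rot filter_cat -{2 4}(cat_take_drop i s) filter_cat.
  by rewrite -size_filter drop_size_cat // take_size_cat.
rewrite -(next_rot j) ?filter_uniq // Ej -!(next_rot i us) E !next_nth !inE ys' eqxx orbT /=.
rewrite eqxx (eq_sym q) (negbTE yq); case: s' us' ys' {E F Ej} => // a s' /= us' ys'.
have le : (index y (a :: s') < (size s').+1)%N by rewrite index_mem.
move: le => /=; set k := (if a == y then _ else _) => le.
have [lt | ge] := ltnP k (size s').
  rewrite (set_nth_default a) //; case: eqP => // qq; move: us'.
  by rewrite -{1}qq !inE mem_nth // orbT.
by rewrite !nth_default // eqxx.
Qed.

Lemma prev_filter s q y : uniq s -> q \in s -> y \in s -> y != q ->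
  prev [seq z <- s | z != q] y = if prev s y == q then prev s q else prev s y.
Proof.
move=> us qs ys yq; set s' := [seq z <- s | z != q].
have us' : uniq s' by rewrite filter_uniq.
have key z : z \in s -> z != q -> next s' z = y -> prev s' y = z.
  by move=> zs zq <-; rewrite prev_next.
case: eqP => [pq | /eqP pq]; last first.
  apply: key => //; first by rewrite mem_prev.
  by rewrite next_filter ?mem_prev // next_prev // (negbTE yq).
have nq : next s q = y by rewrite -pq next_prev.
have pne : prev s q != q.
  by apply: contra yq => /eqP E; rewrite -nq -{1}E next_prev.
apply: key; rewrite ?mem_prev // next_filter ?mem_prev //.
by rewrite next_prev // eqxx.
Qed.

Variable lt : rel T.
Hypothesis lt_asym : forall x y, lt x y -> lt y x = false.

Lemma pairwise_index s y z : pairwise lt s -> uniq s -> y \in s -> z \in s ->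
  lt y z = (index y s < index z s)%N.
Proof.
move=> ps us ys zs; have x0 := y.
have H a b : a \in s -> b \in s -> (index a s < index b s)%N -> lt a b.
  move=> ais bis lab; have := pairwiseP x0 ps (index a s) (index b s).
  by rewrite !inE !index_mem !nth_index //; apply.
have [l | l | e] := ltngtP (index y s) (index z s); first exact: H.
- by rewrite lt_asym ?H.
- rewrite -(nth_index x0 ys) e nth_index //.
  by apply/negP => h; have := lt_asym h; rewrite h.
Qed.

Definition between3 x y z := [|| lt x y && lt y z, lt y z && lt z x | lt z x && lt x y].

Lemma next_between s y z : pairwise lt s -> uniq s -> y \in s -> z \in s ->
  ~~ between3 y z (next s y).
Proof.
move=> ps us ys zs; rewrite /between3 !(pairwise_index ps us) ?mem_next // index_next //.
have := ys; have := zs; rewrite -!index_mem => hz hy.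
case: eqP; lia.
Qed.

Lemma between_next s y z : pairwise lt s -> uniq s -> y \in s -> z \in s ->
  y != z -> z != next s y -> between3 y (next s y) z.
Proof.
move=> ps us ys zs yz zn; rewrite /between3 !(pairwise_index ps us) ?mem_next //.
have ne1 : index y s != index z s.
  by apply: contra yz => /eqP E; rewrite -(nth_index y ys) E nth_index.
have ne2 : index z s != index (next s y) s.
  by apply: contra zn => /eqP E; rewrite -(nth_index y zs) E nth_index // mem_next.
move: ne1 ne2; rewrite index_next //.
have := ys; have := zs; rewrite -!index_mem => hz hy.
case: ((index y s).+1 =P size s); lia.
Qed.

(** Only the step from the last entry back to the first goes against the order: a turn around a
    point passes the cut direction once. *)
Lemma next_wrap s : pairwise lt s -> uniq s -> s != [::] ->
  exists2 y, y \in s & forall z, z \in s -> lt z (next s z) = (z != y).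
Proof.
case: s => // a s ps us _; exists (last a s); first exact: mem_last.
move=> z zs; rewrite (pairwise_index ps us) ?mem_next // index_next //.
have ls : last a s \in a :: s := mem_last a s.
have il : index (last a s) (a :: s) = size s by rewrite index_last.
have -> : (z == last a s) = (index z (a :: s) == size s).
  by rewrite -il; apply/eqP/eqP => [->//|E]; rewrite -(nth_index a zs) E nth_index.
have := zs; rewrite -index_mem [size (a :: s)]/=.
case: (_.+1 =P _); lia.
Qed.

End CyclicSequences.

(** * Number of cycles after the deletion of an edge *)

Section CuttingCycles.
Variable T : finType.
Implicit Types (s : {perm T}) (x y : T).

(** The transposition links the predecessor of [x] to its successor and leaves [x] fixed, which
    creates a cycle unless [x] was fixed before. *)
Lemma card_porbits_bypass s x :
  #|porbits (s * tperm x (s x))| = (#|porbits s| + (s x != x))%N.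
Proof.
have E : (s * tperm x (s x) = tperm (s^-1 x) x * s)%g.
  apply/permP => z; rewrite !permM; case: (tpermP (s^-1%g x)).
  - by move=> ->; rewrite permKV tpermL.
  - by move=> ->; rewrite tpermR permKV.
  move=> z1 z2; rewrite tpermD //.
    by apply/eqP => zx; apply: z1; rewrite zx permK.
  by apply/eqP => /perm_inj/esym.
have := porbits_mul_tperm s (s^-1%g x) x; rewrite /= -E.
have -> : s^-1%g x \in porbit s x.
  by rewrite -(porbitV s); apply: (mem_porbit s^-1 1).
rewrite addn0 => ->; congr (_ + (~~ _))%N.
by apply/eqP/eqP => h; [rewrite -{1}h permKV | rewrite -{1}h permK].
Qed.

(* s' is the face permutation left by s after deleting the edge with darts d, d'. *)
Lemma card_porbits_cut (s s' : {perm T}) d d' :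
  d != d' -> s d != d -> s d' != d' -> s' d = d -> s' d' = d' ->
  (forall e, e != d -> e != d' ->
     s' e = if s e == d then s d' else if s e == d' then s d else s e) ->
  (#|porbits s| < #|porbits s'|)%N.
Proof.
move=> dd sd sd' s'd s'd' s'e.
(* Exchanging the images of [d] and [d'] merges two cycles or splits one; then both darts are
   bypassed. After a merge each bypass adds a cycle, for a net gain of one; after a split the
   bypasses lose nothing. *)
set p := (tperm d d' * s)%g.
have pd : p d = s d' by rewrite permM tpermL.
have pd' : p d' = s d by rewrite permM tpermR.
set p1 := (p * tperm d (p d))%g.
have ne : s d != s d' by rewrite (inj_eq perm_inj).
have p1d' : p1 d' = s d by rewrite permM pd' pd tpermD // eq_sym // ne.
have E : s' = (p1 * tperm d' (p1 d'))%g.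
  apply/permP => e; rewrite permM p1d'.
  have [->|ed] := eqVneq e d.
    by rewrite s'd permM pd tpermR tpermD // eq_sym.
  have [->|ed'] := eqVneq e d'; first by rewrite s'd' p1d' tpermR.
  have pe : p e = s e by rewrite permM tpermD // eq_sym.
  rewrite s'e // permM pe pd.
  have [se | se] := eqVneq (s e) d.
    by rewrite se tpermL tpermD // eq_sym // ne.
  have h1 : d != s e by rewrite eq_sym.
  have h2 : s d' != s e by rewrite (inj_eq perm_inj) eq_sym.
  rewrite (tpermD h1 h2).
  have [->|se'] := eqVneq (s e) d'; first by rewrite tpermL.
  by rewrite tpermD // 1?eq_sym // (inj_eq perm_inj).
have := porbits_mul_tperm s d d'; rewrite /= -/p dd => cp.
rewrite E card_porbits_bypass card_porbits_bypass p1d' pd.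
have [dd' | nd] := boolP (d \in porbit s d').
  by move: cp; rewrite dd' /=; lia.
have -> : s d' != d.
  by apply: contra nd => /eqP <-; apply: (mem_porbit s 1).
have -> : s d != d'.
  by apply: contra nd => /eqP <-; rewrite porbit_sym; apply: (mem_porbit s 1).
move: cp; rewrite nd /=; lia.
Qed.

Lemma sum_porbits s (g : T -> nat) :
  (\sum_x g x = \sum_(A in porbits s) \sum_(y in A) g y)%N.
Proof.
rewrite (eq_bigl (fun x => x \in cover (porbits s))); last first.
  move=> x; rewrite /cover; apply/esym/bigcupP.
  by exists (porbit s x); [exact: imset_f | exact: porbit_id].
rewrite big_trivIset //=; apply/trivIsetP => _ _ /imsetP[x _ ->] /imsetP[y _ ->].
apply: contraR; case/pred0Pn => z /andP[/= zx zy].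
by move: zx zy; rewrite -!eq_porbit_mem => /eqP <- /eqP <-.
Qed.

Lemma leq_sum_porbits s (k : nat) (g : T -> nat) :
  (forall x, k <= \sum_(y in porbit s x) g y)%N ->
  (k * #|porbits s| <= \sum_x g x)%N.
Proof.
move=> H; rewrite (sum_porbits s) mulnC -sum_nat_const.
by apply: leq_sum => _ /imsetP[x _ ->].
Qed.

Lemma geq_sum_porbits s (k : nat) (g : T -> nat) :
  (forall x, \sum_(y in porbit s x) g y <= k)%N ->
  (\sum_x g x <= k * #|porbits s|)%N.
Proof.
move=> H; rewrite (sum_porbits s) mulnC -sum_nat_const.
by apply: leq_sum => _ /imsetP[x _ ->].
Qed.

End CuttingCycles.

(** * Plane graphs and their faces *)

Section RotationSystem.
Variables (R : realFieldType) (P : finType) (pos : P -> R * R).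
Hypothesis pos_inj : injective pos.
Implicit Types (S : {set P * P}) (x y z : P).

Definition orient (a b c : R * R) : R := cross (vec a b) (vec a c).
Definition betw (p a b : R * R) :=
  (cross (vec p a) (vec p b) == 0) && (dotp (vec p a) (vec p b) < 0).
(** Transversal crossings at interior points only; overlaps and points inside an edge are left to
    [visible]. *)
Definition pcross (a b c d : R * R) :=
  (orient a b c * orient a b d < 0) && (orient c d a * orient c d b < 0).

Definition dir x y := vec (pos x) (pos y).
Definition visible x y := (x != y) && [forall p, ~~ betw (pos p) (pos x) (pos y)].

(* S is the set of darts of a plane straight-line graph on P. *)
Definition plane S :=
  [forall d, (d \in S) ==> (((d.2, d.1) \in S) && visible d.1 d.2)] &&
  [forall d, forall e, (d \in S) ==> (e \in S) ==>
     ~~ pcross (pos d.1) (pos d.2) (pos e.1) (pos e.2)].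

Lemma planeP S : reflect
  [/\ forall x y, (x, y) \in S -> (y, x) \in S,
      forall x y, (x, y) \in S -> visible x y &
      forall x y z w, (x, y) \in S -> (z, w) \in S ->
        ~~ pcross (pos x) (pos y) (pos z) (pos w)] (plane S).
Proof.
apply: (iffP andP) => [[/forallP H1 /forallP H2] | [H1 H2 H3]].
  split.
  - by move=> x y xy; have /implyP/(_ xy)/andP[] := H1 (x, y).
  - by move=> x y xy; have /implyP/(_ xy)/andP[] := H1 (x, y).
  - by move=> x y z w xy zw; have /forallP/(_ (z, w))/implyP/(_ xy)/implyP/(_ zw) := H2 (x, y).
split; apply/forallP => -[x y]; first by apply/implyP => xy; rewrite H1 //= H2.
by apply/forallP => -[z w]; apply/implyP => xy; apply/implyP => zw; apply: H3.
Qed.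

Lemma dir_nzv x y : x != y -> nzv (dir x y).
Proof.
rewrite /nzv /dir /vec /= !subr_eq0 -negb_and; apply: contra => /andP[/eqP h1 /eqP h2].
by apply/eqP/pos_inj; rewrite [pos x]surjective_pairing -h1 -h2 -surjective_pairing.
Qed.

Lemma sdir_dot (u v : R * R) : nzv u -> nzv v -> sdir u v -> 0 < dotp u v.
Proof.
move=> nu nv /andP[/eqP l /eqP].
have aux (u' v' : R * R) : lexpos u' -> lexpos v' -> cross u' v' = 0 -> 0 < dotp u' v'.
  case: u' v' => [a b] [c d]; rewrite /cross /dotp /= => /lexposP /= h1 /lexposP /= h2 e.
  case: h1 => [h1|[z1 h1]]; case: h2 => [h2|[z2 h2]]; subst; try nra.
  have : 0 <= b * d.
    have e' : b * c = a * d by lra.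
    by rewrite -(pmulr_rge0 _ h2) mulrA (mulrC c) e' -mulrA -expr2 mulr_ge0 ?sqr_ge0 ?ltW.
  nra.
case L: (lexpos v) l => l; first by apply: aux; rewrite ?l.
have := aux (oppv u) (oppv v); rewrite !lexposN // l L crossNN => /(_ isT isT) H /H.
by rewrite /dotp /= !mulrNN.
Qed.

Lemma visible_sdir x y z :
  visible x y -> visible x z -> sdir (dir x y) (dir x z) -> y = z.
Proof.
move=> /andP[xy /forallP/(_ z) vy] /andP[xz /forallP/(_ y) vz] s.
have := sdir_dot (dir_nzv xy) (dir_nzv xz) s.
case/andP: s => _; move: vy vz; rewrite /betw /cross /dotp /dir /vec /=.
case Ex: (pos x) => [x1 x2]; case Ey: (pos y) => [y1 y2]; case Ez: (pos z) => [z1 z2] /=.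
move=> vy vz /eqP c d.
set a := y1 - x1 in c d *; set b := y2 - x2 in c d *.
set a' := z1 - x1 in c d *; set b' := z2 - x2 in c d *.
(* [k1] and [k2] say that neither of [y], [z] lies strictly between [x] and the other; with equality
   in Cauchy-Schwarz ([k3]) the two vectors coincide. *)
have k1 : a * a' + b * b' <= a' * a' + b' * b'.
  have c0 : (x1 - z1) * (y2 - z2) - (x2 - z2) * (y1 - z1) == 0.
    by apply/eqP; rewrite /a /b /a' /b' in c; lra.
  by move: vy; rewrite c0 /= -leNgt /a /b /a' /b'; lra.
have k2 : a * a' + b * b' <= a * a + b * b.
  have c0 : (x1 - y1) * (z2 - y2) - (x2 - y2) * (z1 - y1) == 0.
    by apply/eqP; rewrite /a /b /a' /b' in c; lra.
  by move: vz; rewrite c0 /= -leNgt /a /b /a' /b'; lra.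
have k3 : (a * a' + b * b') ^+ 2 = (a * a + b * b) * (a' * a' + b' * b').
  have : (a * a + b * b) * (a' * a' + b' * b') = (a * a' + b * b') ^+ 2 + (a * b' - b * a') ^+ 2 by ring.
  by rewrite c expr0n addr0 => ->.
have k4 : a * a + b * b = a * a' + b * b' by nra.
have k5 : a' * a' + b' * b' = a * a' + b * b' by nra.
have k6 : (a - a') ^+ 2 + (b - b') ^+ 2 = 0 by lra.
have /andP[] : ((a - a') ^+ 2 == 0) && ((b - b') ^+ 2 == 0).
  by rewrite -paddr_eq0 ?sqr_ge0 ?k6.
rewrite !sqrf_eq0 !subr_eq0 => /eqP e1 /eqP e2.
apply: pos_inj; rewrite Ey Ez; congr pair; move: e1 e2; rewrite /a /a' /b /b'; lra.
Qed.

(** All other points are sorted once, independently of [S], so that deleting darts merely filters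
    the list. Points in equal directions tie here, but visibility leaves at most one of them in
    [nbrs]. *)
Definition around x :=
  sort (fun y z => ~~ alt (dir x z) (dir x y)) [seq y <- enum P | y != x].
Definition nbrs S x := [seq y <- around x | (x, y) \in S].
Definition rnext S x y := next (nbrs S x) y.

(* The face on the left of a dart is traversed by turning, at its endpoint,
   to the edge preceding it counterclockwise. *)
Definition phi S (d : P * P) :=
  if d \in S then (d.2, prev (nbrs S d.2) d.1) else d.

Lemma mem_around x y : (y \in around x) = (y != x).
Proof. by rewrite mem_sort mem_filter mem_enum andbT. Qed.

Lemma around_uniq x : uniq (around x).
Proof. by rewrite sort_uniq filter_uniq // enum_uniq. Qed.

Lemma nbrs_uniq S x : uniq (nbrs S x).
Proof. by rewrite filter_uniq // around_uniq. Qed.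

Lemma around_sorted x : pairwise (fun y z => ~~ alt (dir x z) (dir x y)) (around x).
Proof.
have trans : {in [pred y | y != x] & &, transitive (fun y z => ~~ alt (dir x z) (dir x y))}.
  move=> y z w; rewrite !inE => yx zx wx; apply: nalt_trans; apply: dir_nzv; by rewrite eq_sym.
rewrite -(sorted_pairwise_in trans); last by apply/allP => y; rewrite mem_around.
apply: (@sort_sorted_in _ [pred y | y != x]); last by apply/allP => y; rewrite mem_filter => /andP[].
move=> y z _ _; case E: (alt (dir x z) (dir x y)) => //=.
by rewrite alt_asym.
Qed.

Section Plane.
Variable S : {set P * P}.
Hypothesis pS : plane S.

Lemma plane_sym x y : (x, y) \in S -> (y, x) \in S.
Proof. by case/planeP: pS => + _ _; apply. Qed.
Lemma plane_vis x y : (x, y) \in S -> visible x y.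
Proof. by case/planeP: pS => _ + _; apply. Qed.
Lemma plane_neq x y : (x, y) \in S -> x != y.
Proof. by case/plane_vis/andP. Qed.
Lemma plane_nzv x y : (x, y) \in S -> nzv (dir x y).
Proof. by move/plane_neq; apply: dir_nzv. Qed.

Lemma mem_nbrs x y : (y \in nbrs S x) = ((x, y) \in S).
Proof.
rewrite mem_filter mem_around andb_idr // => /plane_neq.
by rewrite eq_sym.
Qed.

Lemma nbrs_sorted x : pairwise (fun y z => alt (dir x y) (dir x z)) (nbrs S x).
Proof.
have : pairwise (fun y z => ~~ alt (dir x z) (dir x y)) (nbrs S x).
  by apply: pairwise_filter; apply: around_sorted.
have: all (fun y => (x, y) \in S) (nbrs S x) by apply/allP => y; rewrite mem_nbrs.
have := nbrs_uniq S x; elim: (nbrs S x) => //= y s IHs /andP[ys us] /andP[xy xs] /andP[h1 h2].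
rewrite IHs // andbT; apply/allP => z zs; move/allP/(_ z zs): h1 => h1.
have xz : (x, z) \in S by apply: (allP xs).
have := alt_total (plane_nzv xy) (plane_nzv xz); rewrite (negbTE h1) /= => /orP[//|].
by move/(visible_sdir (plane_vis xy) (plane_vis xz)) => yz; rewrite yz zs in ys.
Qed.

Lemma rnext_mem x y : (x, y) \in S -> (x, rnext S x y) \in S.
Proof. by rewrite -!mem_nbrs mem_next. Qed.

Lemma rnext_inj x y z : rnext S x y = rnext S x z -> y = z.
Proof. by apply: (can_inj (prev_next (nbrs_uniq S x))). Qed.

Let alt_as x y z : alt (dir x y) (dir x z) -> alt (dir x z) (dir x y) = false.
Proof. exact: alt_asym. Qed.

Lemma rnext_sector x y e : (x, y) \in S -> (x, e) \in S ->
  0 < cross (dir x y) (dir x (rnext S x y)) ->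
  0 < cross (dir x y) (dir x e) -> 0 < cross (dir x e) (dir x (rnext S x y)) -> False.
Proof.
move=> xy xe c c1 c2; have xn := rnext_mem xy.
have := next_between (@alt_as x) (nbrs_sorted x) (nbrs_uniq S x).
move/(_ y e); rewrite !mem_nbrs => /(_ xy xe).
rewrite /between3 -/(rnext S x y) -/(ccw3 _ _ _) ccw3_sector ?plane_nzv //.
by rewrite c1 c2.
Qed.

Lemma rnext_eq x y z : (x, y) \in S -> (x, z) \in S -> 0 < cross (dir x y) (dir x z) ->
  (forall e, (x, e) \in S -> 0 < cross (dir x y) (dir x e) ->
     0 < cross (dir x e) (dir x z) -> False) ->
  rnext S x y = z.
Proof.
move=> xy xz c H; have xn := rnext_mem xy; apply/eqP/negPn/negP => ne.
have yz : y != z by apply: contraTneq c => ->; rewrite crossxx ltxx.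
have := between_next (@alt_as x) (nbrs_sorted x) (nbrs_uniq S x).
move/(_ y z); rewrite !mem_nbrs -/(rnext S x y) (eq_sym z) => /(_ xy xz yz ne).
rewrite /between3 -/(ccw3 _ _ _) ccw3_sector ?plane_nzv // => /andP[].
exact: H.
Qed.

Lemma rnext_wrap x y0 : (x, y0) \in S ->
  exists2 y, (x, y) \in S &
    forall z, (x, z) \in S -> alt (dir x z) (dir x (rnext S x z)) = (z != y).
Proof.
move=> xy0; have := next_wrap (@alt_as x) (nbrs_sorted x) (nbrs_uniq S x).
case; first by apply: contraTneq xy0; rewrite -mem_nbrs => ->.
move=> y; rewrite mem_nbrs => xy H; exists y => // z; rewrite -mem_nbrs => /H <- //.
Qed.

Lemma phiE x y z : (y, z) \in S -> rnext S y z = x -> phi S (x, y) = (y, z).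
Proof.
move=> yz <-; rewrite /phi plane_sym ?rnext_mem //=.
by rewrite prev_next // nbrs_uniq.
Qed.

Lemma phi_rnext x y z : (x, y) \in S -> phi S (x, y) = (y, z) -> rnext S y z = x.
Proof.
by move=> xy; rewrite /phi xy /= => -[<-]; rewrite /rnext next_prev // nbrs_uniq.
Qed.

Lemma phi_mem d : d \in S -> phi S d \in S.
Proof.
case: d => x y xy; rewrite /phi xy /= -mem_nbrs mem_prev mem_nbrs.
exact: plane_sym.
Qed.

Lemma phi_fst d : d \in S -> (phi S d).1 = d.2.
Proof. by rewrite /phi => ->. Qed.

Lemma phi_out d : d \notin S -> phi S d = d.
Proof. by rewrite /phi => /negbTE ->. Qed.

Lemma phi_inj : injective (phi S).
Proof.
move=> d e; have [dS | dS] := boolP (d \in S); have [eS | eS] := boolP (e \in S); last first.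
- by rewrite !phi_out.
- by move=> E; have := phi_mem eS; rewrite -E phi_out // (negbTE dS).
- by move=> E; have := phi_mem dS; rewrite E phi_out // (negbTE eS).
rewrite /phi dS eS; case: d e {dS eS} => [x y] [z w] /= [->].
by move/(can_inj (next_prev (nbrs_uniq S w))) ->.
Qed.

Definition face_perm := perm phi_inj.

Lemma face_permE d : face_perm d = phi S d.
Proof. by rewrite permE. Qed.

Lemma phi_neq d : d \in S -> phi S d != d.
Proof.
case: d => x y xy; apply/eqP => E; have := phi_fst xy; rewrite E /= => exy.
by have := plane_neq xy; rewrite exy eqxx.
Qed.

Lemma porbit_in d e : e \in porbit face_perm d -> (e \in S) = (d \in S).
Proof.
case/porbitP => i ->; elim: i => [|i IH]; first by rewrite expg0 perm1.
rewrite expgSr permM face_permE -IH; set f := (_ d).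
have [fS|fS] := boolP (f \in S); first by rewrite phi_mem.
by rewrite phi_out // (negbTE fS).
Qed.

End Plane.

Lemma plane_del S x y : plane S -> plane (S :\ (x, y) :\ (y, x)).
Proof.
case/planeP => H1 H2 H3; apply/planeP; split.
- move=> z w; rewrite !inE !xpair_eqE => /and3P[n1 n2 zw]; rewrite H1 // andbT.
  by rewrite [(w == x) && _]andbC [(w == y) && _]andbC n1 n2.
- by move=> z w; rewrite !inE => /and3P[_ _]; apply: H2.
- by move=> a b c d; rewrite !inE => /and3P[_ _ ab] /and3P[_ _]; apply: H3.
Qed.

(** Only darts that led into the deleted edge get a new image. Its two darts become fixed points,
    which outweighs the face lost when two faces merge. *)
Lemma card_faces_del S (pS : plane S) x y (pS' : plane (S :\ (x, y) :\ (y, x))) :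
  (x, y) \in S -> (#|porbits (face_perm pS)| < #|porbits (face_perm pS')|)%N.
Proof.
set S' := _ :\ _ in pS' * => xy; have yx := plane_sym pS xy; have nxy := plane_neq pS xy.
have n' a b : (a, b) \in S' -> (a, b) \in S by rewrite !inE => /and3P[].
apply: (@card_porbits_cut _ (face_perm pS) (face_perm pS') (x, y) (y, x)).
- by rewrite xpair_eqE negb_and nxy.
- by rewrite face_permE phi_neq.
- by rewrite face_permE phi_neq.
- by rewrite face_permE phi_out // !inE eqxx andbF.
- by rewrite face_permE phi_out // !inE eqxx.
move=> [a b] ne1 ne2; rewrite !face_permE.
have [ab | nab] := boolP ((a, b) \in S); last first.
  rewrite (phi_out nab) (@phi_out S'); last by apply: contra nab; apply: n'.
  by rewrite (negbTE ne1) (negbTE ne2).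
have ab' : (a, b) \in S' by rewrite !inE ne1 ne2.
have ba := plane_sym pS ab.
rewrite /phi ab ab' xy yx /= !xpair_eqE.
have nbE (q : P) : (b, q) \in S ->
    (forall z, ((b, z) \in S') = ((b, z) \in S) && (z != q)) ->
    a != q ->
    prev (nbrs S' b) a = if prev (nbrs S b) a == q then prev (nbrs S b) q else prev (nbrs S b) a.
  move=> bq H aq; rewrite -prev_filter ?nbrs_uniq ?(mem_nbrs pS) //.
  congr (prev _ _); rewrite /nbrs -filter_predI; apply: eq_filter => z /=.
  by rewrite H andbC.
have [bx | bx] := eqVneq b x.
  subst b; rewrite /= (negbTE nxy) /= (nbE y) //.
  - by case: ifP.
  - by move=> z; rewrite !inE !xpair_eqE eqxx (negbTE nxy) /= andbC.
  - by move: ne2; rewrite xpair_eqE eqxx andbT.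
have [by_ | by_] := eqVneq b y.
  subst b; rewrite /= (nbE x) //.
  - by case: ifP.
  - by move=> z; rewrite !inE !xpair_eqE eqxx (negbTE bx) /= andbC.
  - by move: ne1; rewrite xpair_eqE eqxx andbT.
congr (_, prev _ _); apply: eq_filter => z.
by rewrite !inE !xpair_eqE (negbTE bx) (negbTE by_).
Qed.

End RotationSystem.

(** * Maximal plane graphs *)

Section Segments.
Variable R : realFieldType.
Implicit Types (a b c d p x y z u v : R * R).

Definition at_ a b (t : R) : R * R := (a.1 + t * (b.1 - a.1), a.2 + t * (b.2 - a.2)).

Lemma parallel_ratio (p1 p2 w1 w2 : R) :
  p1 * w2 = p2 * w1 -> p1 * p1 + p2 * p2 < p1 * w1 + p2 * w2 ->
  exists2 t, 0 < t < 1 & p1 = t * w1 /\ p2 = t * w2.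
Proof.
move=> c d; set q := p1 * w1 + p2 * w2 in d.
have q0 : 0 < q by have := sqr_ge0 p1; have := sqr_ge0 p2; rewrite !expr2; lra.
have n0 : 0 < w1 * w1 + w2 * w2.
  rewrite lt_neqAle addr_ge0 ?andbT -?expr2 ?sqr_ge0 // eq_sym paddr_eq0 ?sqr_ge0 //.
  rewrite !sqrf_eq0; apply/negP => /andP[/eqP e1 /eqP e2].
  by move: q0; rewrite /q e1 e2 !mulr0 addr0 ltxx.
have q2 : q * q = (p1 * p1 + p2 * p2) * (w1 * w1 + w2 * w2).
  have -> : (p1 * p1 + p2 * p2) * (w1 * w1 + w2 * w2) =
      q * q + (p1 * w2 - p2 * w1) * (p1 * w2 - p2 * w1) by rewrite /q; ring.
  by rewrite c; ring.
exists (q / (w1 * w1 + w2 * w2)).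
  rewrite divr_gt0 //= ltr_pdivrMr // mul1r.
  by rewrite -(ltr_pM2l q0) q2 ltr_pM2r.
have f1 : q * w1 = p1 * (w1 * w1 + w2 * w2).
  have -> : q * w1 = p1 * (w1 * w1) + (p2 * w1) * w2 by rewrite /q; ring.
  by rewrite -c; ring.
have f2 : q * w2 = p2 * (w1 * w1 + w2 * w2).
  have -> : q * w2 = p2 * (w2 * w2) + (p1 * w2) * w1 by rewrite /q; ring.
  by rewrite c; ring.
by rewrite ![q / _ * _]mulrAC f1 f2 !mulfK ?gt_eqF.
Qed.

Lemma betw_at p a b : betw p a b -> exists2 t, 0 < t < 1 & p = at_ a b t.
Proof.
rewrite /betw /cross /dotp /vec /at_; case: p a b => [p1 p2] [a1 a2] [b1 b2] /=.
move=> /andP[/eqP c d].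
have [||t t01 [e1 e2]] := @parallel_ratio (p1 - a1) (p2 - a2) (b1 - a1) (b2 - a2); try lra.
by exists t; rewrite // -e1 -e2 !subrKC.
Qed.

Lemma at_betw a b t : 0 < t < 1 -> nzv (vec a b) -> betw (at_ a b t) a b.
Proof.
rewrite /nzv /betw /cross /dotp /vec /at_; case: a b => [a1 a2] [b1 b2] /= /andP[t0 t1] n.
apply/andP; split; first by apply/eqP; ring.
have n0 : 0 < (b1 - a1) ^+ 2 + (b2 - a2) ^+ 2.
  rewrite lt_neqAle addr_ge0 ?andbT ?sqr_ge0 // eq_sym paddr_eq0 ?sqr_ge0 //.
  by rewrite !sqrf_eq0 negb_and.
have -> : (a1 - (a1 + t * (b1 - a1))) * (b1 - (a1 + t * (b1 - a1))) +
   (a2 - (a2 + t * (b2 - a2))) * (b2 - (a2 + t * (b2 - a2))) =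
  - (t * (1 - t) * ((b1 - a1) ^+ 2 + (b2 - a2) ^+ 2)) by ring.
by rewrite oppr_lt0 mulr_gt0 // mulr_gt0 // subr_gt0.
Qed.

Lemma pcross_sym a b c d : pcross a b c d = pcross c d a b.
Proof. by rewrite /pcross andbC. Qed.

Lemma orientC a b c : orient a b c = - orient b a c.
Proof. by rewrite /orient /cross /vec /=; ring. Qed.

Lemma pcross_rev a b c d : pcross a b c d = pcross b a c d.
Proof.
by rewrite /pcross (orientC a b c) (orientC a b d) mulrNN [orient c d b * _]mulrC.
Qed.

Lemma pcross_self a b c : pcross a b a c = false.
Proof.
rewrite /pcross (_ : orient a b a = 0) ?mul0r ?ltxx //.
by rewrite /orient /cross /vec /=; ring.
Qed.

Lemma pcross_at a b c d : pcross a b c d ->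
  exists r t, [/\ 0 < r < 1, 0 < t < 1 & at_ a b r = at_ c d t].
Proof.
move=> /andP[h1 h2].
(* [x / (x - y)] is the parameter at which an affine function with end values [x] and [y]
   vanishes. *)
have frac (x y : R) : x * y < 0 -> 0 < x / (x - y) < 1 /\ x - y != 0.
  move=> xy; have n : x - y != 0.
    by apply: contraTneq xy => /eqP; rewrite subr_eq0 => /eqP ->; rewrite -leNgt -expr2 sqr_ge0.
  have p : 0 < (x - y) ^+ 2 by rewrite lt_neqAle sqr_ge0 eq_sym sqrf_eq0 n.
  split=> //; have -> : x / (x - y) = (x * (x - y)) / (x - y) ^+ 2 by field.
  rewrite divr_gt0 //=; last by rewrite mulrBr subr_gt0 (lt_le_trans xy) // -expr2 sqr_ge0.
  rewrite ltr_pdivrMr // mul1r expr2 mulrBl ltrDl mulrBr -subr_gt0 opprB.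
  by have := sqr_ge0 y; rewrite expr2; nra.
have [r01 nr] := frac _ _ h2; have [t01 nt] := frac _ _ h1.
exists (orient c d a / (orient c d a - orient c d b)).
exists (orient a b c / (orient a b c - orient a b d)); split=> //.
move: nr nt; rewrite /at_ /orient /cross /vec.
case: a b c d {h1 h2 r01 t01} => [a1 a2] [b1 b2] [c1 c2] [d1 d2] /= nr nt.
by congr pair; field; rewrite nr nt.
Qed.

(* Cone coordinates of p at x: beta and gamma vanish on the rays xz and xy,
   and beta + gamma equals orient x y z exactly on the line yz. *)
Definition beta x z p := cross (vec x p) (vec x z).
Definition gamma x y p := cross (vec x y) (vec x p).

Lemma beta_at x z a b t : beta x z (at_ a b t) = (1 - t) * beta x z a + t * beta x z b.
Proof. by rewrite /beta /cross /vec /at_ /=; ring. Qed.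

Lemma gamma_at x y a b t : gamma x y (at_ a b t) = (1 - t) * gamma x y a + t * gamma x y b.
Proof. by rewrite /gamma /cross /vec /at_ /=; ring. Qed.

(** The segment meets the line [beta = 0] before parameter [t], with gamma equal to
    [(ga * bb - ba * gb) / (bb - ba)]. Since beta + gamma does not decrease and is at most [D] at
    [t], one of the two strictly, this value is below [D]; the conclusion clears the denominator. *)
Lemma exit_bound (D ba bb ga gb t : R) :
  0 < t < 1 -> ba < 0 -> 0 < (1 - t) * ba + t * bb ->
  ba + ga <= bb + gb ->
  (1 - t) * (ba + ga) + t * (bb + gb) <= D ->
  ba + ga < bb + gb \/ (1 - t) * (ba + ga) + t * (bb + gb) < D ->
  0 < bb /\ 0 < (bb - ba) * D + (ba * gb - ga * bb).
Proof.
move=> /andP[t0 t1] ba0 bs fab fs strict.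
have bb0 : 0 < bb.
  rewrite -(pmulr_rgt0 _ t0).
  have : 0 < (1 - t) * (- ba) by rewrite mulr_gt0 ?subr_gt0 ?oppr_gt0.
  by lra.
split=> //.
have p1 : 0 < bb - ba by lra.
have -> : (bb - ba) * D + (ba * gb - ga * bb) =
  (bb - ba) * (D - ((1 - t) * (ba + ga) + t * (bb + gb))) +
  ((1 - t) * ba + t * bb) * (bb + gb - (ba + ga)) by ring.
have q1 : 0 <= (bb - ba) * (D - ((1 - t) * (ba + ga) + t * (bb + gb))).
  by apply: mulr_ge0; [exact: ltW | rewrite subr_ge0].
have q2 : 0 <= ((1 - t) * ba + t * bb) * (bb + gb - (ba + ga)).
  by apply: mulr_ge0; [exact: ltW | rewrite subr_ge0].
case: strict => st.
  by rewrite ltr_wpDl // mulr_gt0 // subr_gt0.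
by rewrite ltr_wpDr // mulr_gt0 // subr_gt0.
Qed.

(* A segment entering the corner at x from a point a outside the cone crosses
   one of the sides xy, xz or passes through x. *)
Lemma corner_exit x y z a b t :
  0 < orient x y z -> 0 < t < 1 ->
  0 < beta x z (at_ a b t) -> 0 < gamma x y (at_ a b t) ->
  beta x z a + gamma x y a <= beta x z b + gamma x y b ->
  beta x z (at_ a b t) + gamma x y (at_ a b t) <= orient x y z ->
  beta x z a + gamma x y a < beta x z b + gamma x y b \/
    beta x z (at_ a b t) + gamma x y (at_ a b t) < orient x y z ->
  [\/ 0 <= beta x z a /\ 0 <= gamma x y a, betw x a b,
      pcross a b x z | pcross a b x y].
Proof.
move=> D0 t01 bs gs fab fs st.
have /andP[t0 t1] := t01.
set D := orient x y z in D0 fs st.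
set k := cross (vec x a) (vec x b).
(* [k] tells on which side of [x] the line [ab] passes; this expresses it in cone coordinates. *)
have Dk : D * k = beta x z a * gamma x y b - gamma x y a * beta x z b.
  by rewrite /D /k /orient /beta /gamma /cross /vec /=; ring.
have Ez : orient a b z = beta x z b - beta x z a + k.
  by rewrite /k /orient /beta /cross /vec /=; ring.
have Ex : orient a b x = k by rewrite /k /orient /cross /vec /=; ring.
have Ey : orient a b y = gamma x y a - gamma x y b + k.
  by rewrite /k /orient /gamma /cross /vec /=; ring.
have Eza c : orient x z c = - beta x z c by rewrite /orient /beta /cross /=; ring.
have Eya c : orient x y c = gamma x y c by [].
have par : k = 0 -> beta x z a * beta x z b < 0 -> betw x a b.
  move=> k0 ab; rewrite /betw -/k k0 eqxx /=.
  have n : beta x z b != 0 by apply: contraTneq ab => ->; rewrite mulr0 ltxx.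
  have b2 : 0 < beta x z b ^+ 2 by rewrite lt_neqAle sqr_ge0 eq_sym sqrf_eq0 n.
  rewrite -(pmulr_rlt0 _ b2).
  have -> : beta x z b ^+ 2 * dotp (vec x a) (vec x b) =
     (beta x z a * beta x z b) * dotp (vec x b) (vec x b) -
     k * beta x z b * dotp (vec x z) (vec x b).
    by rewrite /k /beta /dotp /cross /=; ring.
  rewrite k0 !mul0r subr0 nmulr_rlt0 //.
  rewrite /dotp -!expr2 lt_neqAle addr_ge0 ?sqr_ge0 // andbT eq_sym.
  rewrite paddr_eq0 ?sqr_ge0 // !sqrf_eq0; apply: contra n => /andP[/eqP e1 /eqP e2].
  by rewrite /beta /cross e1 e2 !mul0r subr0.
move: bs gs fs st; rewrite beta_at gamma_at.
set ba := beta x z a in Dk Ez par fab *; set bb := beta x z b in Dk Ez par fab *.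
set ga := gamma x y a in Dk Ey fab *; set gb := gamma x y b in Dk Ey fab * => bs gs fs st.
have [hb|ba0] := leP 0 ba.
  have [hg|ga0] := leP 0 ga; first by constructor 1.
  have k0 : 0 < k.
    rewrite -(pmulr_rgt0 _ D0) Dk -(pmulr_rgt0 _ t0).
    have -> : t * (ba * gb - ga * bb) = ba * ((1 - t) * ga + t * gb) + (- ga) * ((1 - t) * ba + t * bb) by ring.
    by rewrite ltr_wpDl ?mulr_ge0 ?mulr_gt0 ?oppr_gt0 // ltW.
  have [|||gb0 h] := @exit_bound D ga gb ba bb t t01 ga0 gs; try lra.
  constructor 4; rewrite /pcross Ex Ey !Eya -/ga -/gb.
  rewrite (nmulr_rlt0 _ ga0) gb0 andbT pmulr_rlt0 // -(pmulr_rlt0 _ D0).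
  by move: h Dk; clear; lra.
(* The segment enters across [xz], across [xy], or through [x], according to the sign of [k]. *)
have [k0|k0|k0] := ltgtP k 0.
- have [|||bb0 h] := @exit_bound D ba bb ga gb t t01 ba0 bs; try lra.
  constructor 3; rewrite /pcross Ex Ez !Eza -/ba -/bb mulrNN.
  rewrite (nmulr_rlt0 _ ba0) bb0 andbT nmulr_rlt0 // -(pmulr_rgt0 _ D0).
  by move: h Dk; clear; lra.
- have ga0 : ga < 0.
    rewrite ltNge; apply/negP => ga0.
    have : 0 < t * (ba * gb - ga * bb) by rewrite mulr_gt0 // -Dk mulr_gt0.
    have -> : t * (ba * gb - ga * bb) = - ((- ba) * ((1 - t) * ga + t * gb) + ga * ((1 - t) * ba + t * bb)) by ring.
    rewrite oppr_gt0 ltNge; apply/negP/negPn.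
    by apply: addr_ge0; apply: mulr_ge0; rewrite ?oppr_ge0 // ltW.
  have [|||gb0 h] := @exit_bound D ga gb ba bb t t01 ga0 gs; try lra.
  constructor 4; rewrite /pcross Ex Ey !Eya -/ga -/gb.
  rewrite (nmulr_rlt0 _ ga0) gb0 andbT pmulr_rlt0 // -(pmulr_rlt0 _ D0).
  by move: h Dk; clear; lra.
- constructor 2; apply: par => //; rewrite nmulr_rlt0 //.
  rewrite -(pmulr_rgt0 _ t0).
  have : 0 < (1 - t) * (- ba) by rewrite mulr_gt0 ?subr_gt0 ?oppr_gt0.
  by move: bs; clear; lra.
Qed.

End Segments.

(** * Convex corners of a maximal plane graph *)

Section MaximalPlaneGraph.
Variables (R : realFieldType) (P : finType) (pos : P -> R * R).
Hypothesis pos_inj : injective pos.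
Implicit Types (S T : {set P * P}) (x y z : P).

Local Notation dir := (dir pos).
Local Notation visible := (visible pos).
Local Notation plane := (plane pos).
Local Notation rnext := (rnext pos).

Definition maximal_plane T := forall x y, visible x y -> (x, y) \notin T ->
  exists z w, (z, w) \in T /\ pcross (pos x) (pos y) (pos z) (pos w).

Lemma visible_sym x y : visible x y = visible y x.
Proof.
rewrite /visible eq_sym; congr (_ && _); apply: eq_forallb => p.
rewrite /betw [cross (vec _ (pos x)) _]crossC oppr_eq0 /dotp.
by rewrite ![_ * (vec _ (pos y)).1]mulrC ![_ * (vec _ (pos y)).2]mulrC.
Qed.

Lemma plane_add T x y : plane T -> visible x y ->
  (forall z w, (z, w) \in T -> ~~ pcross (pos x) (pos y) (pos z) (pos w)) ->
  plane ((x, y) |: ((y, x) |: T)).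
Proof.
move=> /planeP[H1 H2 H3] v H; apply/planeP; split.
- move=> a b; rewrite !inE !xpair_eqE.
  case/or3P => [/andP[/eqP -> /eqP ->]|/andP[/eqP -> /eqP ->]|/H1 ->]; rewrite ?eqxx ?orbT //.
- move=> a b; rewrite !inE !xpair_eqE.
  case/or3P => [/andP[/eqP -> /eqP ->]//|/andP[/eqP -> /eqP ->]|/H2 //].
  by rewrite visible_sym.
have self (a b : P) : pcross (pos a) (pos b) (pos a) (pos b) = false by apply: pcross_self.
have H' z w : (z, w) \in T -> pcross (pos x) (pos y) (pos z) (pos w) = false.
  by move=> zw; apply/negbTE/H.
move=> a b c d; rewrite !inE !xpair_eqE.
case/or3P => [/andP[/eqP -> /eqP ->]|/andP[/eqP -> /eqP ->]|ab];
  case/or3P => [/andP[/eqP -> /eqP ->]|/andP[/eqP -> /eqP ->]|cd].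
- by rewrite self.
- by rewrite pcross_sym pcross_rev pcross_self.
- by rewrite H'.
- by rewrite pcross_rev pcross_self.
- by rewrite self.
- by rewrite pcross_rev H'.
- by rewrite pcross_sym H'.
- by rewrite pcross_sym pcross_rev H'.
- exact: H3.
Qed.

Lemma plane_maximal S : plane S ->
  exists T, [/\ plane T, S \subset T & maximal_plane T].
Proof.
move=> pS; case: (@arg_maxnP _ S (fun T => plane T && (S \subset T)) (fun T => #|T|)).
  by rewrite pS subxx.
move=> T /andP[pT sT] mx; exists T; split=> // x y v nxy.
have [/existsP[z /existsP[w /andP[zw c]]]|/existsPn H] :=
  boolP [exists z, exists w, ((z, w) \in T) && pcross (pos x) (pos y) (pos z) (pos w)].
  by exists z, w.
have := mx ((x, y) |: ((y, x) |: T)); rewrite plane_add //=; last first.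
  by move=> z w zw; have /existsPn/(_ w) := H z; rewrite zw.
rewrite (subset_trans sT) ?setUA ?subsetUr // => /(_ isT).
rewrite -setUA cardsU1 !inE (negbTE nxy) orbF xpair_eqE.
have xy : x != y by case/andP: v.
rewrite (negbTE xy) /= add1n ltnNge => /negP[]; apply: subset_leq_card.
exact: subsetUr.
Qed.

Lemma on_side x y w t : visible x y -> 0 <= t <= 1 ->
  pos w = at_ (pos x) (pos y) t -> w = x \/ w = y.
Proof.
move=> /andP[xy /forallP/(_ w) nb] /andP[t0 t1] E.
have [t00|nt0] := eqVneq t 0.
  left; apply: pos_inj; rewrite E t00 /at_ !mul0r !addr0.
  by rewrite -surjective_pairing.
have [t11|nt1] := eqVneq t 1.
  by right; apply: pos_inj; rewrite E t11 /at_ !mul1r !subrKC -surjective_pairing.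
move: nb; rewrite E at_betw //; last exact: dir_nzv.
by rewrite !lt_neqAle t0 t1 nt1 eq_sym nt0.
Qed.

Variable T : {set P * P}.
Hypothesis pT : plane T.
Hypothesis maxT : maximal_plane T.

Section Corner.
Variables x y z : P.
Hypothesis xy : (x, y) \in T.
Hypothesis xyz : rnext T x y = z.
Hypothesis convex : 0 < orient (pos x) (pos y) (pos z).

Let xz : (x, z) \in T. Proof. by rewrite -xyz rnext_mem. Qed.

Local Notation b := (fun p => beta (pos x) (pos z) (pos p)).
Local Notation g := (fun p => gamma (pos x) (pos y) (pos p)).
Local Notation D := (orient (pos x) (pos y) (pos z)).

Let bx : b x = 0. Proof. by rewrite /beta /cross /=; ring. Qed.
Let gx : g x = 0. Proof. by rewrite /gamma /cross /=; ring. Qed.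
Let by_ : b y = D. Proof. by []. Qed.
Let gy : g y = 0. Proof. exact: crossxx. Qed.
Let bz : b z = 0. Proof. exact: crossxx. Qed.
Let gz : g z = D. Proof. by []. Qed.

Let at_cone w : pos w = ((pos x).1 + (b w / D * ((pos y).1 - (pos x).1) + g w / D * ((pos z).1 - (pos x).1)),
  (pos x).2 + (b w / D * ((pos y).2 - (pos x).2) + g w / D * ((pos z).2 - (pos x).2))).
Proof.
have D0 : D != 0 by rewrite gt_eqF.
rewrite [LHS]surjective_pairing; congr pair; apply: (mulfI D0).
  transitivity (D * (pos x).1 + b w * ((pos y).1 - (pos x).1) + g w * ((pos z).1 - (pos x).1)).
    by rewrite /orient /beta /gamma /cross /vec /=; ring.
  by move: D0; move: D (b w) (g w) => D' b' g' D0; field.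
transitivity (D * (pos x).2 + b w * ((pos y).2 - (pos x).2) + g w * ((pos z).2 - (pos x).2)).
  by rewrite /orient /beta /gamma /cross /vec /=; ring.
by move: D0; move: D (b w) (g w) => D' b' g' D0; field.
Qed.

Let sector p : (x, p) \in T -> 0 < b p -> 0 < g p -> False.
Proof.
move=> xp bp gp.
by apply: (rnext_sector pos_inj pT xy xp); rewrite ?xyz.
Qed.

(* No edge enters the corner below every vertex of the cone. *)
Let corner_free m (c d : P) t :
  m <= D -> (forall p, p != x -> 0 <= b p -> 0 <= g p -> m <= b p + g p) ->
  (c, d) \in T -> 0 < t < 1 ->
  0 < beta (pos x) (pos z) (at_ (pos c) (pos d) t) ->
  0 < gamma (pos x) (pos y) (at_ (pos c) (pos d) t) ->
  beta (pos x) (pos z) (at_ (pos c) (pos d) t) +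
    gamma (pos x) (pos y) (at_ (pos c) (pos d) t) <= m ->
  b c + g c < b d + g d \/
   (b c + g c <= b d + g d /\ beta (pos x) (pos z) (at_ (pos c) (pos d) t) +
    gamma (pos x) (pos y) (at_ (pos c) (pos d) t) < m) ->
  False.
Proof.
move=> mD mn cd t01 bs gs fs st; have /andP[t0 t1] := t01.
have fcd : b c + g c <= b d + g d by case: st => [/ltW|[]].
have [||||||||||] := @corner_exit _ (pos x) (pos y) (pos z) (pos c) (pos d) t => //.
- exact: le_trans mD.
- by case: st => [h|[_ h]]; [left | right; apply: lt_le_trans mD].
- move=> [bc gc]; have [E|ne] := eqVneq c x.
    subst c; apply: (sector cd).
      by move: bs; rewrite beta_at bx mulr0 add0r pmulr_rgt0.
    by move: gs; rewrite gamma_at gx mulr0 add0r pmulr_rgt0.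
  have := mn _ ne bc gc; apply/negP; rewrite -ltNge.
  move: fs st; rewrite beta_at gamma_at => fs [st|[st1 st2]].
    apply: lt_le_trans fs; rewrite -subr_gt0.
    have -> : (1 - t) * b c + t * b d + ((1 - t) * g c + t * g d) - (b c + g c) = t * (b d + g d - (b c + g c)) by ring.
    by rewrite mulr_gt0 // subr_gt0.
  apply: le_lt_trans st2; rewrite -subr_ge0.
  have -> : (1 - t) * b c + t * b d + ((1 - t) * g c + t * g d) - (b c + g c) = t * (b d + g d - (b c + g c)) by ring.
  by rewrite mulr_ge0 ?subr_ge0 // ltW.
- by have /andP[_ /forallP/(_ x)/negP] := plane_vis pT cd.
- by case/planeP: pT => _ _ /(_ c d x z cd xz)/negP.
- by case/planeP: pT => _ _ /(_ c d x y cd xy)/negP.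
Qed.

(** Frees [corner_free] from its orientation: one of the two directions of the edge makes beta +
    gamma nondecreasing. *)
Let pcross_free m (c d : P) (s u : R) (q1 q2 : R * R) :
  m <= D -> (forall p, p != x -> 0 <= b p -> 0 <= g p -> m <= b p + g p) ->
  (c, d) \in T -> at_ q1 q2 s = at_ (pos c) (pos d) u -> 0 < u < 1 ->
  0 < beta (pos x) (pos z) (at_ q1 q2 s) ->
  0 < gamma (pos x) (pos y) (at_ q1 q2 s) ->
  beta (pos x) (pos z) (at_ q1 q2 s) + gamma (pos x) (pos y) (at_ q1 q2 s) <= m ->
  b c + g c != b d + g d \/
  beta (pos x) (pos z) (at_ q1 q2 s) + gamma (pos x) (pos y) (at_ q1 q2 s) < m ->
  False.
Proof.
move=> mD mn cd E u01 h1 h2 h3 h4.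
have dc := plane_sym pT cd.
have E' : at_ q1 q2 s = at_ (pos d) (pos c) (1 - u).
  by rewrite E /at_; congr pair; ring.
have u01' : 0 < 1 - u < 1 by case/andP: u01 => *; apply/andP; split; lra.
case: (ltgtP (b c + g c) (b d + g d)) => fcd.
- by rewrite E in h1 h2 h3 h4; apply: (corner_free mD mn cd u01) => //; left.
- by rewrite E' in h1 h2 h3 h4; apply: (corner_free mD mn dc u01') => //; left.
- case: h4 => [|h4]; first by rewrite fcd eqxx.
  rewrite E in h1 h2 h3 h4; apply: (corner_free mD mn cd u01) => //; right.
  by rewrite fcd.
Qed.

(** Among the points in the closed triangle other than its corners, take [w] with beta + gamma
    least. Nothing blocks the view from [x] to [w], and [xw] is no edge because [y] and [z] are
    consecutive at [x]; so by maximality an edge crosses [xw], entering the corner below [w], which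
    is impossible. *)
Lemma corner_empty p : p != x -> p != y -> p != z -> 0 <= b p -> 0 <= g p ->
  D < b p + g p.
Proof.
move=> p1 p2 p3 bp gp; rewrite ltNge; apply/negP => fp.
pose Q := [pred p | [&& p != x, p != y, p != z, 0 <= b p, 0 <= g p & b p + g p <= D]].
have Qp : Q p by rewrite /= p1 p2 p3 bp gp fp.
case: (@arg_minP _ _ _ p Q (fun p => b p + g p) Qp) => w /= Qw mn.
case/and5P: Qw => w1 w2 w3 bw /andP[gw fw] {p p1 p2 p3 bp gp fp Qp}.
have mn' q : q != x -> 0 <= b q -> 0 <= g q -> b w + g w <= b q + g q.
  move=> q1 bq gq.
  have [->|q2] := eqVneq q y; first by rewrite by_ gy addr0.
  have [->|q3] := eqVneq q z; first by rewrite bz gz add0r.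
  have [fq|/ltW fq] := leP (b q + g q) D; last exact: le_trans fq.
  by apply: mn; rewrite q1 q2 q3 bq gq fq.
have bw0 : 0 < b w.
  rewrite lt_neqAle bw andbT; apply/eqP => e; move: fw; rewrite -e add0r => fw.
  have h : 0 <= g w / D <= 1 by rewrite divr_ge0 ?(ltW convex) //= ler_pdivrMr // mul1r.
  have E : pos w = at_ (pos x) (pos z) (g w / D) by rewrite [LHS]at_cone -e /at_ !mul0r !add0r.
  by case: (on_side (plane_vis pT xz) h E) => /eqP; apply/negP.
have gw0 : 0 < g w.
  rewrite lt_neqAle gw andbT; apply/eqP => e; move: fw; rewrite -e addr0 => fw.
  have h : 0 <= b w / D <= 1 by rewrite divr_ge0 ?(ltW convex) //= ler_pdivrMr // mul1r.
  have E : pos w = at_ (pos x) (pos y) (b w / D) by rewrite [LHS]at_cone -e /at_ !mul0r !addr0.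
  by case: (on_side (plane_vis pT xy) h E) => /eqP; apply/negP.
have nxw : (x, w) \notin T by apply/negP => xw; apply: (sector xw).
have vxw : visible x w.
  rewrite /visible eq_sym w1 /=; apply/forallP => q; apply/negP => /betw_at[t t01 Eq].
  have /andP[t0 t1] := t01.
  have q1 : b q = t * b w by rewrite Eq beta_at bx mulr0 add0r.
  have q2 : g q = t * g w by rewrite Eq gamma_at gx mulr0 add0r.
  have qx : q != x by apply: contraTneq t0 => e; move: q1; rewrite e bx => /esym/eqP; rewrite mulf_eq0 (gt_eqF bw0) orbF => /eqP ->; rewrite ltxx.
  have := mn' _ qx; rewrite q1 q2 -mulrDr => /(_ (mulr_ge0 (ltW t0) bw) (mulr_ge0 (ltW t0) gw)).
  have s0 : 0 < b w + g w by rewrite addr_gt0.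
  by rewrite leNgt (gtr_pMl _ s0) t1.
have [c [d [cd cr]]] := maxT vxw nxw.
have [r [u [/andP[r0 r1] u01 E]]] := pcross_at cr.
have bs : beta (pos x) (pos z) (at_ (pos x) (pos w) r) = r * b w by rewrite beta_at bx mulr0 add0r.
have gs : gamma (pos x) (pos y) (at_ (pos x) (pos w) r) = r * g w by rewrite gamma_at gx mulr0 add0r.
have s0 : 0 < b w + g w by rewrite addr_gt0.
have fs : r * b w + r * g w < b w + g w by rewrite -mulrDr (gtr_pMl _ s0).
apply: (pcross_free fw mn' cd E u01); rewrite ?bs ?gs ?mulr_gt0 //; first exact: ltW.
by right.
Qed.

(** The triangle being empty, [y] sees [z], and an edge crossing [yz] would enter the corner at [x];
    maximality then makes [yz] an edge. An edge at [y] inside the triangle would have to end there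
    or leave through [xz]. *)
Lemma corner_closed : (y, z) \in T /\ rnext T y z = x.
Proof.
have D0 : D != 0 by rewrite gt_eqF.
have yz : y != z by apply/eqP => e; move: convex; rewrite -e /orient crossxx ltxx.
have mn p : p != x -> 0 <= b p -> 0 <= g p -> D <= b p + g p.
  move=> p1 bp gp.
  have [->|p2] := eqVneq p y; first by rewrite by_ gy addr0.
  have [->|p3] := eqVneq p z; first by rewrite bz gz add0r.
  exact/ltW/corner_empty.
have bt t : beta (pos x) (pos z) (at_ (pos y) (pos z) t) = (1 - t) * D.
  by rewrite beta_at bz mulr0 addr0.
have gt t : gamma (pos x) (pos y) (at_ (pos y) (pos z) t) = t * D.
  by rewrite gamma_at gy mulr0 add0r.
have vyz : visible y z.
  rewrite /visible yz /=; apply/forallP => q; apply/negP => qb.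
  have /betw_at[t /andP[t0 t1] Eq] := qb.
  have b0 : 0 < b q by rewrite Eq bt mulr_gt0 // subr_gt0.
  have g0 : 0 < g q by rewrite Eq gt mulr_gt0.
  have := @corner_empty q.
  have -> : b q + g q = D by rewrite Eq bt gt; ring.
  rewrite ltxx => H; suff: false by []; apply: H; rewrite ?ltW //.
  - by apply: contraTneq b0 => ->; rewrite bx ltxx.
  - by apply: contraTneq g0 => ->; rewrite gy ltxx.
  - by apply: contraTneq b0 => ->; rewrite bz ltxx.
have oyz p : orient (pos y) (pos z) (pos p) = D - (b p + g p).
  by rewrite /orient /beta /gamma /cross /vec /=; ring.
have yzT : (y, z) \in T.
  apply/negPn/negP => nyz; have [c [d [cd cr]]] := maxT vyz nyz.
  have [r [u [/andP[r0 r1] u01 E]]] := pcross_at cr.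
  have k1 : 0 < (1 - r) * D by rewrite mulr_gt0 // subr_gt0.
  have k2 : 0 < r * D by rewrite mulr_gt0.
  apply: (pcross_free (lexx _) mn cd E u01); rewrite ?bt ?gt //.
    by rewrite -mulrDl subrK mul1r.
  (* The crossing lies on [yz], at level [D] itself; strictness comes from [c] and [d] being on
     different sides of that line. *)
  left; case/andP: cr => + _; rewrite !oyz => cr.
  by apply: contraTneq cr => ->; rewrite -leNgt -expr2 sqr_ge0.
split=> //; have yx := plane_sym pT xy.
apply: (rnext_eq pos_inj pT) => //.
  by move: convex; rewrite /orient /cross /vec /=; lra.
move=> e ye c1 c2.
have fe : b e + g e < D by rewrite -subr_gt0 -oyz.
have ge : 0 < g e.
  by move: c2; rewrite /gamma /cross /vec /=; lra.
have [be|be] := leP 0 (b e).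
  have := @corner_empty e; rewrite ltNge (ltW fe) => H; suff: false by []; apply: H; rewrite ?(ltW ge) //.
  - by apply: contraTneq ge => ->; rewrite gx ltxx.
  - by apply: contraTneq ge => ->; rewrite gy ltxx.
  - by apply: contraTneq fe => ->; rewrite bz gz add0r ltxx.
(* Here the edge [ye] leaves the triangle through its side [xz]. *)
case/planeP: pT => _ _ /(_ y e x z ye xz)/negP; apply; apply/andP; split.
  have -> : orient (pos y) (pos e) (pos x) = g e by rewrite /orient /gamma /cross /vec /=; ring.
  have -> : orient (pos y) (pos e) (pos z) = b e + g e - D.
    by rewrite /orient /beta /gamma /cross /vec /=; ring.
  by rewrite pmulr_rlt0 // subr_lt0.
have -> : orient (pos x) (pos z) (pos y) = - D by rewrite /orient /cross /vec /=; ring.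
have -> : orient (pos x) (pos z) (pos e) = - b e by rewrite /orient /beta /cross /vec /=; ring.
by rewrite mulrNN pmulr_rlt0.
Qed.

End Corner.

Definition convex d :=
  0 < orient (pos d.1) (pos d.2) (pos (rnext T d.1 d.2)).

Lemma convex_phi x y : (x, y) \in T -> convex (x, y) ->
  [/\ phi pos T (x, y) = (y, rnext T x y), convex (y, rnext T x y) &
      phi pos T (y, rnext T x y) = (rnext T x y, x)].
Proof.
move=> xy c; have [yz E] := corner_closed xy erefl c; set z := rnext T x y in yz E *.
have yzx : 0 < orient (pos y) (pos z) (pos x).
  by move: c; rewrite /convex /orient /cross /vec /=; lra.
have [zx E'] := corner_closed yz E yzx.
split.
- by apply: (phiE pT).
- by rewrite /convex /= E.
- by apply: (phiE pT).
Qed.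

End MaximalPlaneGraph.

(** * Euler's inequality *)

Section EulerInequality.
Variables (R : realFieldType) (P : finType).

Lemma lexmin_exists (pos : P -> R * R) (x0 : P) : injective pos ->
  exists x, forall y, x != y -> lexpos (vec (pos x) (pos y)).
Proof.
move=> pos_inj.
case: (@arg_minP _ _ _ x0 predT (fun x => (pos x).1)) => // a _ amin.
case: (@arg_minP _ _ _ a (fun x => (pos x).1 == (pos a).1) (fun x => (pos x).2)) => // x xa xmin.
exists x => y xy; apply/lexposP; rewrite /vec /= !subr_gt0.
have := amin y isT; rewrite -(eqP xa) le_eqVlt => /orP[/eqP e|]; last by left.
right; split; first by rewrite e subrr.
have := xmin y; rewrite -e xa => /(_ isT); rewrite le_eqVlt => /orP[/eqP e2|//].
case/eqP: xy; apply: pos_inj.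
by rewrite [pos x]surjective_pairing [pos y]surjective_pairing e e2.
Qed.

Variable pos : P -> R * R.
Hypothesis pos_inj : injective pos.

Local Notation dir := (dir pos).

Lemma lexmax_exists (x0 : P) : exists x, forall y, x != y -> lexpos (dir x y) = false.
Proof.
have [|x H] := @lexmin_exists (fun x => oppv (pos x)) x0.
  by move=> x y e; apply: pos_inj; rewrite -[pos x]oppvK e oppvK.
exists x => y xy; have := H y xy.
have -> : vec (oppv (pos x)) (oppv (pos y)) = oppv (dir x y).
  by rewrite /dir /vec /oppv /=; congr pair; ring.
by rewrite lexposN ?dir_nzv // => /negbTE.
Qed.

(** Pairs outside [S] are fixed by [phi] and count as one face each. This is why [#|{: P * P}|]
    appears in the inequalities: the true number of faces is [nfaces] minus the number of such
    pairs. *)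
Definition nfaces (S : {set P * P}) (pS : plane pos S) := #|porbits (face_perm pS)|.

(** Deleting an edge removes two darts and raises [nfaces] by at least one, so [2 * nfaces + #|S|]
    never drops. Euler's inequality thus descends from a maximal graph to its subgraphs. *)
Lemma nfaces_sub (S T : {set P * P}) (pS : plane pos S) (pT : plane pos T) :
  S \subset T -> (2 * nfaces pT + #|T| <= 2 * nfaces pS + #|S|)%N.
Proof.
move: {2}#|T| (leqnn #|T|) => n; elim: n T pT => [|n IH] T pT le sST.
  have T0 : T = set0 by apply/eqP; rewrite -cards_eq0 -leqn0.
  have S0 : S = T by apply/eqP; rewrite eqEsubset sST T0 sub0set.
  by subst S; rewrite (eq_irrelevance pT pS).
have [E|ne] := eqVneq S T.
  by subst S; rewrite (eq_irrelevance pT pS).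
have : T :\: S != set0.
  by apply: contra ne; rewrite setD_eq0 => sTS; rewrite eqEsubset sST.
case/set0Pn => -[x y]; rewrite inE => /andP[nxy xy].
have yx := plane_sym pT xy; have dxy := plane_neq pT xy.
have pT' : plane pos (T :\ (x, y) :\ (y, x)) by apply: plane_del.
have yxS : (y, x) \notin S by apply: contra nxy; apply: (plane_sym pS).
have lt := card_faces_del pT pT' xy.
have cT : #|T| = (#|T :\ (x, y) :\ (y, x)|).+2.
  rewrite (cardsD1 (x, y) T) xy (cardsD1 (y, x) (T :\ _)) !inE yx xpair_eqE.
  by rewrite (eq_sym y) (negbTE dxy) !add1n.
have := IH _ pT'; rewrite cT in le *; move=> /(_ (ltnW le)) h.
have : S \subset T :\ (x, y) :\ (y, x) by rewrite !subsetD1 sST nxy yxS.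
move/h; rewrite /nfaces; move: lt; lia.
Qed.

Section Maximal.
Variable T : {set P * P}.
Hypothesis pT : plane pos T.
Hypothesis maxT : maximal_plane pos T.
Hypothesis no_isolated : forall x, exists y, (x, y) \in T.

Local Notation cvx := (convex pos T).
Local Notation rn := (rnext pos T).
Let sg (d : P * P) := (d.1, rn d.1 d.2).
Let dv (d : P * P) := dir d.1 d.2.

(* The number of sides of the vertical line through d.1, lexicographically
   perturbed, whose germ at d.1 lies in the corner between d and its successor. *)
Let mu (d : P * P) : nat :=
  (~~ alt (dv d) (dv (sg d))) + (~~ alt (oppv (dv d)) (oppv (dv (sg d)))).

Let sgT d : (sg d \in T) = (d \in T).
Proof. by case: d => x y; rewrite /sg /= -!(mem_nbrs pT) mem_next. Qed.

Let sg_inj : injective sg.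
Proof. by case=> [x y] [z w] [/= -> /(rnext_inj)->]. Qed.

Let nz d : d \in T -> nzv (dv d).
Proof. by case: d => x y; apply: plane_nzv. Qed.

(** The sides of a corner lie in different half planes exactly when one of the two vertical germs is
    inside; otherwise none is inside a convex corner and both are inside a nonconvex one. *)
Let muE d : d \in T ->
  mu d = if lexpos (dv d) == lexpos (dv (sg d)) then (~~ cvx d).*2 else 1%N.
Proof.
move=> dT; have n1 := nz dT; have n2 : nzv (dv (sg d)) by rewrite nz ?sgT.
rewrite /mu /alt !lexposN // crossNN -/(cvx d).
by case: (lexpos (dv d)); case: (lexpos (dv (sg d))); case: (cvx d).
Qed.

Let sum_wrap : (\sum_(d in T) ~~ alt (dv d) (dv (sg d)) = #|P|)%N.
Proof.
rewrite (eq_bigl (fun d => predT d.1 && ((d.1, d.2) \in T))); last by case.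
rewrite -(pair_big_dep predT (fun x y => (x, y) \in T)
  (fun x y => nat_of_bool (~~ alt (dir x y) (dir x (rn x y))))) /=.
rewrite -sum1_card; apply: eq_bigr => x _.
have [y0 xy0] := no_isolated x; have [y xy H] := rnext_wrap pos_inj pT xy0.
rewrite (bigD1 y) //= H // eqxx big1 // => z /andP[xz zy].
by rewrite H // zy.
Qed.

Let sum_mu : (\sum_(d in T) mu d = 2 * #|P|)%N.
Proof.
rewrite big_split /= sum_wrap mul2n -addnn; congr addn.
(* At each corner the counts for the two vertical directions differ by the difference of [lexpos] at
   its two sides. Since [sg] permutes [T], these differences cancel in the sum. *)
apply/eqP; rewrite -(eqn_add2r (\sum_(d in T) lexpos (dv (sg d)))) -big_split /=.
rewrite -sum_wrap.
have -> : (\sum_(d in T) lexpos (dv (sg d)) = \sum_(d in T) lexpos (dv d))%N.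
  rewrite [RHS](reindex_inj sg_inj) /=.
  by apply: eq_bigl => d; rewrite sgT.
rewrite -big_split /=; apply/eqP/eq_bigr => d dT.
have n1 := nz dT; have n2 : nzv (dv (sg d)) by rewrite nz ?sgT.
rewrite /alt !lexposN // crossNN.
by case: (lexpos (dv d)); case: (lexpos (dv (sg d))); case: (0 < cross _ _).
Qed.

Let C := [set d in T | cvx d].

Let phiC d : d \in C -> phi pos T d \in C.
Proof.
rewrite !inE => /andP[dT]; case: d dT => x y dT /(convex_phi pos_inj pT maxT dT)[e c _].
by rewrite e c -e phi_mem.
Qed.

Let imC : [set phi pos T d | d in C] = C.
Proof.
apply/eqP; rewrite eqEcard card_imset ?leqnn; last exact: phi_inj.
by rewrite andbT; apply/subsetP => _ /imsetP[d dC ->]; apply: phiC.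
Qed.

Let sumC (f : P * P -> nat) : (\sum_(d in C) f (phi pos T d) = \sum_(d in C) f d)%N.
Proof. by rewrite -[in RHS]imC big_imset //= => d e _ _; apply: (phi_inj pT). Qed.

Let lexpos_cycle x y z :
  ~~ [&& lexpos (dir x y), lexpos (dir y z) & lexpos (dir z x)].
Proof.
apply/negP => /and3P[/lexposP h1 /lexposP h2 /lexposP h3].
by move: h1 h2 h3; rewrite /dir /vec /=; lra.
Qed.

(** Of the perturbed vertical lines through the corners of a triangle, only that through the
    lexicographically middle corner enters the triangle, and on one side. *)
Let triangle_mu d : d \in C ->
  (mu d + mu (phi pos T d) + mu (phi pos T (phi pos T d)) = 1)%N.
Proof.
move=> dC; have d1C := phiC dC; have d2C := phiC d1C.
have inT e : e \in C -> e \in T by rewrite inE => /andP[].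
have cv e : e \in C -> cvx e by rewrite inE => /andP[].
rewrite !muE ?inT // !cv //=.
case: d dC d1C d2C => x y dC d1C d2C.
have xyT := inT _ dC; have c := cv _ dC.
have [yzT E] := corner_closed pos_inj pT maxT xyT erefl c.
have [e1 c1 e2] := convex_phi pos_inj pT maxT xyT c.
have [zxT E'] : (rn x y, x) \in T /\ rn (rn x y) x = y.
  by apply: (corner_closed pos_inj pT maxT yzT E); move: c1; rewrite /convex /= E.
rewrite e1 e2 /dv /sg /= E E'; set z := rn x y in yzT zxT *.
have opp (a b : P) : (a, b) \in T -> lexpos (dir b a) = ~~ lexpos (dir a b).
  move=> ab; rewrite -(lexposN (plane_nzv pos_inj pT ab)); congr lexpos.
  by rewrite /dir /vec /oppv /= !opprB.
have := lexpos_cycle x y z; have := lexpos_cycle x z y.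
rewrite (opp _ _ xyT) (opp _ _ yzT) (opp _ _ zxT).
by case: (lexpos (dir x y)); case: (lexpos (dir y z)); case: (lexpos (dir z x)).
Qed.

Let sum_mu_convex : (#|C| <= 3 * \sum_(d in C) mu d)%N.
Proof.
have -> : (3 * \sum_(d in C) mu d = \sum_(d in C) mu d +
    \sum_(d in C) mu (phi pos T d) + \sum_(d in C) mu (phi pos T (phi pos T d)))%N.
  by rewrite (sumC (fun d => mu (phi pos T d))) (sumC mu); lia.
rewrite -sum1_card -!big_split /=; apply: leq_sum => d dC.
by rewrite -(triangle_mu dC).
Qed.

(** At a lexicographically extreme vertex all edges lie in one half plane, so a single corner
    contains both vertical germs. *)
Let h_corner x b : (forall y, x != y -> lexpos (dir x y) = b) ->
  exists d, [/\ d \in T, ~~ cvx d, mu d = 2%N & lexpos (dv d) = b].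
Proof.
move=> H; have [y0 xy0] := no_isolated x; have [y xy w] := rnext_wrap pos_inj pT xy0.
exists (x, y); have xn := rnext_mem pT xy.
have := w _ xy; rewrite eqxx /= => nalt.
have Ly : lexpos (dir x y) = b by apply/H/(plane_neq pT).
have Ln : lexpos (dir x (rn x y)) = b by apply/H/(plane_neq pT).
have nc : ~~ cvx (x, y).
  by move/negbT: nalt; rewrite alt_same ?Ly ?Ln.
by split=> //; rewrite muE // /dv /sg /= Ly Ln eqxx nc.
Qed.

(** With [C] the convex and [N] the other darts, [sum_mu] gives [2 * #|P| >= #|C| / 3 + #|N| + 2],
    the 2 coming from the two extreme vertices. The faces made of darts of [T] number at least
    [#|C| / 3 + 1]. The first bound plus twice the second is the claim. *)
Lemma euler_maximal (x0 : P) :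
  (2 * #|{: P * P}| + 4 <= 2 * nfaces pT + #|T| + 2 * #|P|)%N.
Proof.
have [xm Hm] := lexmin_exists x0 pos_inj; have [xM HM] := lexmax_exists x0.
have [d1 [d1T c1 m1 l1]] := @h_corner xm true Hm.
have [d2 [d2T c2 m2 l2]] := @h_corner xM false HM.
have d12 : d2 != d1 by apply/eqP => e; move: l2; rewrite e l1.
pose N := [set d in T | ~~ cvx d].
have cT : #|T| = (#|C| + #|N|)%N.
  rewrite -(cardsID C T); congr (_ + _)%N; apply: eq_card => d; rewrite !inE.
    by rewrite andbA andbb.
  by case: (d \in T); rewrite ?andbT ?andbF.
have sN : (#|N| + 2 <= \sum_(d in N) mu d)%N.
  have d1N : d1 \in N by rewrite inE d1T.
  have d2N : d2 \in N by rewrite inE d2T.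
  have one d : d \in N -> (\sum_(e in N) (e == d) = 1)%N.
    move=> dN; rewrite (bigD1 d) //= eqxx big1 // => e /andP[_ /negbTE ->] //.
  have -> : (#|N| + 2 = \sum_(d in N) (1 + (d == d1) + (d == d2)))%N.
    by rewrite !big_split /= sum1_card !one // -addnA.
  apply: leq_sum => d; rewrite inE => /andP[dT nc].
  have [->|n1] := eqVneq d d1; first by rewrite m1 eq_sym (negbTE d12).
  have [->|n2] := eqVneq d d2; first by rewrite m2.
  by rewrite muE // nc; case: ifP.
have sum : (\sum_(d in T) mu d = \sum_(d in C) mu d + \sum_(d in N) mu d)%N.
  rewrite (bigID cvx) /=; congr (_ + _)%N; apply: eq_bigl => d; by rewrite !inE.
have faces : (3 * #|~: T| + #|C| + 3 <= 3 * nfaces pT)%N.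
  (* No cycle gets more than 3: a pair outside [T] is alone in its cycle, convex darts form cycles
     of at most three, and any other cycle gets 3 only if it contains [d1]. That last cycle supplies
     the additional face. *)
  pose g d : nat := if d \notin T then 3%N else if cvx d then 1%N else if d == d1 then 3%N else 0%N.
  have -> : (3 * #|~: T| + #|C| + 3 = \sum_d g d)%N.
    rewrite (bigID (mem T)) /=.
    have -> : (\sum_(d in T) g d = #|C| + 3)%N.
      rewrite (bigID cvx) /=; congr addn.
        rewrite -sum1_card; apply: congr_big => // d; rewrite ?inE //.
        by case/andP=> dT c; rewrite /g dT c.
      rewrite (bigD1 d1) /=; last by rewrite d1T.
      rewrite /g d1T (negbTE c1) eqxx big1 // => d /andP[/andP[dT c] n].
      by rewrite dT (negbTE c) (negbTE n).
    have -> : (\sum_(d | d \notin T) g d = 3 * #|~: T|)%N; last by rewrite -addnA addnC.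
    rewrite mulnC -sum_nat_const; apply: congr_big => // d; rewrite ?inE //.
    by move=> dT; rewrite /g dT.
  apply: geq_sum_porbits => d.
  have sub (A : {set P * P}) : d \in A -> (forall e, e \in A -> phi pos T e \in A) ->
      porbit (face_perm pT) d \subset A.
    move=> dA H; apply/subsetP => _ /porbitP[i ->].
    elim: i => [|i IH]; first by rewrite expg0 perm1.
    by rewrite expgSr permM face_permE H.
  have [dT|dT] := boolP (d \in T); last first.
    have s1 : porbit (face_perm pT) d \subset [set d].
      by apply: sub; rewrite ?inE // => e; rewrite !inE => /eqP ->; rewrite phi_out.
    rewrite (eq_bigl (pred1 d)) ?big_pred1_eq; first by rewrite /g dT.
    move=> e; apply/idP/eqP => [/(subsetP s1)|->]; last exact: porbit_id.
    by rewrite inE => /eqP.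
  have [c|c] := boolP (cvx d).
    have dC : d \in C by rewrite inE dT.
    have sC : porbit (face_perm pT) d \subset C by apply: sub.
    have s3 : porbit (face_perm pT) d \subset [set d; phi pos T d; phi pos T (phi pos T d)].
      have d3 : phi pos T (phi pos T (phi pos T d)) = d.
        case: (d) dT c => x y xyT c.
        have [yzT E] := corner_closed pos_inj pT maxT xyT erefl c.
        have [e1 c1' e2] := convex_phi pos_inj pT maxT xyT c.
        have [e3 c3 e4] := convex_phi pos_inj pT maxT yzT c1'.
        by rewrite E in e4; rewrite e1 e2 e4.
      apply: sub; first by rewrite !inE eqxx.
      by move=> e; rewrite !inE => /orP[/orP[]|] /eqP ->; rewrite ?d3 ?eqxx ?orbT.
    apply: (@leq_trans #|porbit (face_perm pT) d|).
      rewrite -sum1_card; apply: leq_sum => e /(subsetP sC).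
      by rewrite inE /g => /andP[-> ->].
    apply: leq_trans (subset_leq_card s3) _.
    by rewrite -setUA !cardsU1 cards1; case: (_ \notin _); case: (_ \notin _).
  apply: (@leq_trans (\sum_(e in porbit (face_perm pT) d) 3 * (e == d1))%N).
    apply: leq_sum => e ed; have eT : e \in T by rewrite (porbit_in ed).
    have ce : ~~ cvx e.
      apply: contra c => ce; have eC : e \in C by rewrite inE eT.
      suff : d \in C by rewrite inE => /andP[].
      rewrite porbit_sym in ed; case/porbitP: ed => i ->.
      elim: i => [|i IH]; first by rewrite expg0 perm1.
      by rewrite expgSr permM face_permE phiC.
    by rewrite /g eT (negbTE ce); case: (e == d1).
  rewrite -big_distrr /= -[X in (_ <= X)%N]muln1 leq_mul2l /=.
  have [h|h] := boolP (d1 \in porbit (face_perm pT) d).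
    by rewrite (bigD1 d1) //= eqxx big1 // => e /andP[_ /negbTE ->].
  rewrite big1 // => e he; case: eqP => // e1; by rewrite -e1 he in h.
have cM : (#|{: P * P}| = #|T| + #|~: T|)%N by rewrite cardsC.
move: sum_mu sum_mu_convex; rewrite sum cM.
move: faces cT sN; lia.
Qed.

End Maximal.

Lemma euler_inequality (S : {set P * P}) (pS : plane pos S) (x0 : P) :
  (forall x, exists y, (x, y) \in S) ->
  (2 * #|{: P * P}| + 4 <= 2 * nfaces pS + #|S| + 2 * #|P|)%N.
Proof.
move=> iso; have [T [pT sST maxT]] := plane_maximal pS.
have isoT x : exists y, (x, y) \in T.
  by have [y xy] := iso x; exists y; apply: (subsetP sST).
have := euler_maximal pT maxT isoT x0; have := nfaces_sub pS pT sST; lia.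
Qed.

End EulerInequality.

(** * Discharging *)

Section Discharging.
Variables (R : realFieldType) (P : finType) (pos : P -> R * R).
Variable H : {set P * P}.
Hypothesis pH : plane pos H.
Variable V : {set P}.

Local Notation rn := (rnext pos H).
Local Notation phi := (phi pos H).
Local Notation fp := (face_perm pH).

Hypothesis opposite : forall x y, x \notin V -> (x, y) \in H ->
  betw (pos x) (pos y) (pos (rn x (rn x y))).
Hypothesis corner_pos : forall x y, x \notin V -> (x, y) \in H ->
  0 < orient (pos x) (pos y) (pos (rn x y)).
Hypothesis no_digon : forall d, d \in H -> phi (phi d) != d.
Hypothesis no_tri_pent : forall d, d \in H -> (forall i, (iter i phi d).1 \notin V) ->
  iter 3 phi d != d /\ iter 5 phi d != d.

Let rev (d : P * P) := (d.2, d.1).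

Lemma betw_sym (p a b : R * R) : betw p a b = betw p b a.
Proof.
rewrite /betw [cross (vec p a) _]crossC oppr_eq0 /dotp.
by rewrite ![_ * (vec p b).1]mulrC ![_ * (vec p b).2]mulrC.
Qed.

Lemma betw_extend (v p c e : R * R) : betw p v c -> betw c p e -> betw c v e.
Proof.
move=> /betw_at[t /andP[t0 t1] ->]; have t1' : 0 < 1 - t by rewrite subr_gt0.
rewrite /betw.
have -> : cross (vec c (at_ v c t)) (vec c e) = (1 - t) * cross (vec c v) (vec c e).
  by rewrite /cross /vec /at_ /=; ring.
have -> : dotp (vec c (at_ v c t)) (vec c e) = (1 - t) * dotp (vec c v) (vec c e).
  by rewrite /dotp /vec /at_ /=; ring.
by rewrite mulf_eq0 (gt_eqF t1') pmulr_rlt0.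
Qed.

Lemma betw_orient (v p q c c' : R * R) : betw p v c -> betw q v c' ->
  orient v p q != 0 -> orient v c c' != 0.
Proof.
move=> /betw_at[t _ ->] /betw_at[s _ ->]; apply: contra => /eqP E.
have -> : orient v (at_ v c t) (at_ v c' s) = t * s * orient v c c'.
  by rewrite /orient /cross /vec /at_ /=; ring.
by rewrite E mulr0.
Qed.

Definition quad d := [&& d \in H, iter 4 phi d == d, d.1 \notin V,
  (phi d).1 \notin V & ((iter 2 phi d).1 \notin V) && ((iter 3 phi d).1 \notin V)].

(* d is the side opposite to the vertex of a triangular face with one vertex in V. *)
Definition tri d := [&& d \in H, iter 3 phi d == d, d.1 \notin V,
  (phi d).1 \notin V & (iter 2 phi d).1 \in V].

Let tau d := rev (phi (phi d)).

Let tau_inj : injective tau.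
Proof.
move=> d e; case E: (phi (phi d)) => [a b]; case E': (phi (phi e)) => [a' b'].
rewrite /tau E E' /rev /= => -[e1 e2]; move: E; rewrite e1 e2 -E'.
by do 2!move/(phi_inj pH).
Qed.

(** [v] is the position of the vertex of the triangle where the request began. The sides before and
    after [d] in its face lie on two distinct lines through [v], pointing away from [v]. *)
Let Inv (d : P * P) := exists v c c', [/\ (c, d.1) \in H, phi (c, d.1) = d,
  phi d = (d.2, c'), betw (pos d.1) v (pos c) /\ betw (pos d.2) v (pos c') &
  orient v (pos d.1) (pos d.2) != 0] /\ [/\ d \in H, d.1 \notin V & d.2 \notin V].

Let phi_step x y : (x, y) \in H ->
  exists z, [/\ phi (x, y) = (y, z), (y, z) \in H & rn y z = x].
Proof.
move=> xy; exists (phi (x, y)).2.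
have E : phi (x, y) = (y, (phi (x, y)).2) by rewrite {1}[phi _]surjective_pairing phi_fst.
by split=> //; [rewrite -E phi_mem | exact: phi_rnext].
Qed.

Let Inv_start b : tri b -> Inv (rev b).
Proof.
case: b => a b' /and5P[abH /eqP /= e3 aV bV vV].
have [v [e1 bvH r1]] := phi_step abH; rewrite e1 /= in bV vV e3.
have [a' [e2 vaH r2]] := phi_step bvH; rewrite e2 /= in vV e3.
have [b'' [e4 abH' r3]] := phi_step vaH; move: e3; rewrite e4 => -[E1 E2]; subst a' b''.
have baH : (b', a) \in H by apply: (plane_sym pH).
have [c' [e5 acH r4]] := phi_step baH.
exists (pos v), (rn b' a), c'; split; last by [].
have bcH := rnext_mem pH baH.
split=> //=.
- exact: (plane_sym pH).
- exact: (phiE pH).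
- split; first by rewrite -r1; apply: opposite.
  by have := opposite aV acH; rewrite r4 r3 betw_sym.
- by rewrite orientC oppr_eq0 gt_eqF // -r1 corner_pos.
Qed.

(** The side opposite to [d] joins [c] and [c']; at these crossings [opposite] continues the same
    two lines into the next face. *)
Let Inv_step d : Inv d -> quad d -> Inv (tau d).
Proof.
case: d => p q [v [c [c' [[cpH e0 e1 [b1 b2] o] [pqH pV qV]]]]] /and5P[_ /eqP /= e4 _ _ /andP[cV' cV]].
rewrite /= in e0 e1 b1 b2 o pqH pV qV.
have qcH : (q, c') \in H by rewrite -e1 phi_mem.
rewrite e1 /= in cV' cV e4.
have [c2 [e2 ccH r2]] := phi_step qcH; rewrite e2 /= in cV' cV e4.
have E : phi (c', c2) = (c, p) by apply: (phi_inj pH); rewrite e4.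
have E2 : c2 = c by have := phi_fst pos ccH; rewrite E.
subst c2; have r3 := phi_rnext ccH E.
have r0 := phi_rnext cpH e0; have r1 := phi_rnext pqH e1.
rewrite E /= in cV.
rewrite /tau e1 e2 /rev /=.
have cc'H : (c, c') \in H by apply: (plane_sym pH).
have [e [e5 ceH r5]] := phi_step cc'H.
exists v, (rn c c'), e; split; last by split.
have cnH := rnext_mem pH cc'H.
split=> //=.
- exact: (plane_sym pH).
- exact: (phiE pH).
- split.
    by apply: (betw_extend b1); rewrite -r3; apply: opposite.
  apply: (betw_extend b2); rewrite betw_sym.
  by have := opposite cV' ceH; rewrite r5 r2.
- exact: betw_orient b1 b2 o.
Qed.

(** In a triangle [c] and [c'] would be the same point, on two lines that meet only at [v]. *)
Let Inv_not3 d : Inv d -> iter 3 phi d != d.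
Proof.
case: d => p q [v [c [c' [[cpH e0 e1 [b1 b2] o] [pqH pV qV]]]]].
rewrite /= in e0 e1 b1 b2 o pqH *; apply/eqP => e3.
have qcH : (q, c') \in H by rewrite -e1 phi_mem.
have [c2 [e2 ccH r2]] := phi_step qcH.
have E : phi (q, c') = (c, p) by apply: (phi_inj pH); rewrite -e1 e3 e0.
move: E; rewrite e2 => -[E1 E2]; subst c'.
have := betw_orient b1 b2 o; rewrite /orient.
by rewrite crossxx eqxx.
Qed.

Let quad_iter d : quad d -> forall i, (iter i phi d).1 \notin V.
Proof.
move=> /and5P[_ /eqP e4 v0 v1 /andP[v2 v3]] i.
rewrite (divn_eq i 4) addnC iterD.
have -> : iter (i %/ 4 * 4) phi d = d.
  by elim: (i %/ 4)%N => // k IH; rewrite mulSn iterD IH.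
by have := ltn_pmod i (isT : 0 < 4)%N; move: (i %% 4)%N => [|[|[|[|]]]].
Qed.

Let tri_not_quad d b : tri b -> quad d -> tau d != rev b.
Proof.
move=> /and5P[_ _ _ _ bV] qd; apply/eqP => E.
have E' : phi (phi d) = b.
  by move: E; rewrite /tau /rev; case: (phi (phi d)) (b) => [x y] [z w] /= [-> ->].
by have := quad_iter qd 4; rewrite -E' /= in bV *; rewrite bV.
Qed.

Let len b := find (fun k => ~~ quad (iter k tau (rev b))) (iota 0 (fingraph.order tau (rev b))).

(* The demand of a triangle b is passed across quadrilaterals to the dart exit b. *)
Let exit b := iter (len b) tau (rev b).

(** If the search over one period of [tau] met only quadrilaterals, its last dart would be mapped by
    [tau] to [rev b], so [b] would lie on a face with crossings only; but the face of [b] has a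
    vertex. *)
Let exitP b : tri b ->
  ~~ quad (exit b) /\ forall k, (k < len b)%N -> quad (iter k tau (rev b)).
Proof.
move=> tb; set N := fingraph.order tau (rev b).
have N0 : (0 < N)%N := fingraph.order_gt0 tau (rev b).
have hs : has (fun k => ~~ quad (iter k tau (rev b))) (iota 0 N).
  apply/negPn/negP => /hasPn H'.
  have := H' N.-1; rewrite mem_iota /= add0n prednK // leqnn negbK => /(_ isT).
  move/(tri_not_quad tb); rewrite -iterS prednK // iter_order ?eqxx //.
split.
  have := nth_find 0%N hs; rewrite nth_iota ?add0n //.
  by move: hs; rewrite has_find size_iota.
move=> k kl; have := before_find 0%N kl; rewrite nth_iota; first by move/negbFE.
by rewrite (leq_trans kl) // /len (leq_trans (find_size _ _)) ?size_iota.
Qed.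

Let exit_Inv b : tri b -> Inv (exit b).
Proof.
move=> tb; have [_ qk] := exitP tb; rewrite /exit.
elim: (len b) qk => [|n IH] qk; first exact: Inv_start.
by rewrite iterS; apply: Inv_step; [apply: IH => k kn; apply: qk; rewrite ltnS ltnW | exact: qk].
Qed.

Let iter_tau_inj k : injective (iter k tau).
Proof. by elim: k => // k IH x y /= /tau_inj/IH. Qed.

(** As [tau] is injective, two requests with the same exit can be traced back together. If one path
    were longer, it would reach the start of the other from a quadrilateral, against
    [tri_not_quad]. *)
Let exit_inj : {in [set b | tri b] &, injective exit}.
Proof.
have aux b b' : (len b <= len b')%N -> tri b -> tri b' -> exit b = exit b' -> b = b'.
  move=> le tb tb'; have [_ q'] := exitP tb'.
  rewrite /exit -(subnKC le) iterD => /iter_tau_inj.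
  case D: (len b' - len b)%N => [|m] /=.
    by case: (b) (b') => [x y] [z w]; rewrite /rev /= => -[-> ->].
  move=> E; have /(tri_not_quad tb) : quad (iter m tau (rev b')) by apply: q'; lia.
  by rewrite E eqxx.
move=> b b'; rewrite !inE => tb tb' E; have [le|/ltnW le] := leqP (len b) (len b').
  exact: aux.
by apply/esym/aux.
Qed.

Let M := [set exit b | b in [set b | tri b]].

Let MP d : d \in M -> [/\ d \in H, ~~ quad d, iter 3 phi d != d, d.1 \notin V & d.2 \notin V].
Proof.
case/imsetP => b; rewrite inE => tb ->; have [nq _] := exitP tb.
have I := exit_Inv tb; have n3 := Inv_not3 I.
by case: I => [v [c [c' [_ []]]]].
Qed.

(** Three times the charge after discharging, minus v(f), plus 12, spread over the sides of a face:
    the final bound v(f) / 3 says that the sum is at least 12. A side in [M] pays one unit, a [tri]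
    side receives one. Pairs outside [H] form their own cycles, hence 12. *)
Let g d : nat := (if d \in H then 2 + (d \notin M) + 2 * (d.1 \in V) + tri d else 12)%N.

Let iter_porbit_phi i d : iter i phi d \in porbit fp d.
Proof.
have -> : iter i phi d = (fp ^+ i)%g d; last exact: mem_porbit.
elim: i => [|i IH]; first by rewrite expg0 perm1.
by rewrite expgSr permM -IH face_permE.
Qed.

Let in_porbit d e : e \in porbit fp d -> exists i, e = iter i phi d.
Proof.
case/porbitP => i ->; exists i.
elim: i => [|i IH]; first by rewrite expg0 perm1.
by rewrite expgSr permM IH face_permE.
Qed.

Let iter_card d : iter #|porbit fp d| phi d = d.
Proof.
rewrite -[RHS](iter_porbit fp d); elim: #|_| => // n IH.
by rewrite !iterS IH face_permE.
Qed.

Let face_charge d : d \in H -> (12 <= \sum_(e in porbit fp d) g e)%N.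
Proof.
move=> dH; set O := porbit fp d.
have OH e : e \in O -> e \in H by move/porbit_in => ->.
have Ophi e : e \in O -> phi e \in O.
  by case/in_porbit => i ->; rewrite -iterS; apply: iter_porbit_phi.
have Oeq e : e \in O -> porbit fp e = O by rewrite -eq_porbit_mem => /eqP.
have Ocard e : e \in O -> iter #|O| phi e = e by move/Oeq <-; apply: iter_card.
have K3 : (3 <= #|O|)%N.
  have := Ocard d (porbit_id _ _); have := card_porbit_neq0 fp d; rewrite -/O.
  case: #|O| => [|[|[|]]] //= _ E.
    by have := phi_neq pH dH; rewrite E eqxx.
  by have := no_digon dH; rewrite E eqxx.
have -> : (\sum_(e in O) g e = 2 * #|O| + \sum_(e in O) (e \notin M) +
    2 * #|[set e in O | e.1 \in V]| + \sum_(e in O) tri e)%N.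
  transitivity (\sum_(e in O) (2 + (e \notin M) + 2 * (e.1 \in V) + tri e))%N.
    by apply: eq_bigr => e eO; rewrite /g OH.
  have eV : (\sum_(e in O) 2 * (e.1 \in V) = 2 * #|[set e in O | e.1 \in V]|)%N.
    rewrite -big_distrr; congr muln.
    rewrite -sum1_card [LHS]big_mkcond [RHS]big_mkcond; apply: eq_bigr => e _.
    by rewrite inE; case: (e \in O); case: (e.1 \in V).
  by rewrite 3!big_split /= sum_nat_const eV (mulnC 2 #|O|).
have Mcard : (\sum_(e in O) (e \notin M) = #|O :\: M|)%N.
  rewrite -sum1_card [LHS]big_mkcond [RHS]big_mkcond; apply: eq_bigr => e _.
  by rewrite inE; case: (e \in O); case: (e \in M).
set nV := #|[set e in O | e.1 \in V]|; rewrite Mcard.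
have [v0|vn0] := posnP nV.
  have nVO e : e \in O -> e.1 \notin V.
    move=> eO; apply/negP => eV; move: v0; rewrite /nV => /eqP; rewrite cards_eq0.
    by move/eqP/setP/(_ e); rewrite !inE eO eV.
  have nVi i : (iter i phi d).1 \notin V by apply: nVO; apply: iter_porbit_phi.
  have [n3 n5] := no_tri_pent dH nVi.
  have cd := Ocard d (porbit_id _ _).
  have k3 : #|O| != 3%N by apply: contra n3 => /eqP <-; rewrite cd.
  have k5 : #|O| != 5%N by apply: contra n5 => /eqP <-; rewrite cd.
  have [k6|k6] := leqP 6 #|O|; first by move: k6; lia.
  have k4 : #|O| = 4%N by move: K3 k3 k5 k6; case: #|O| => [|[|[|[|[|[|]]]]]].
  (* A quadrilateral of crossings only passes requests on and pays none, so its sum is 8 + 4. *)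
  have -> : O :\: M = O.
    apply/setDidPl/pred0P => e /=; apply/negP => /andP[eO /MP[_ nq _ _ _]]; case/negP: nq.
    have nVe i : (iter i phi e).1 \notin V.
      by apply: nVO; rewrite -(Oeq e eO); apply: iter_porbit_phi.
    by rewrite /quad OH // -{1}k4 Ocard // eqxx (nVe 0%N) (nVe 1%N) (nVe 2) (nVe 3).
  by rewrite k4; lia.
have [vK|vK] := leqP #|O| nV.
  by move: K3 vK vn0; lia.
(* A side from a crossing to a vertex pays nothing, and neither do the sides starting at vertices.
   So at least [nV + 1] sides are outside [M], which suffices from four sides on: 8 + 2 + 2. *)
have [e [eO eV eV']] : exists e, [/\ e \in O, e.1 \notin V & (phi e).1 \in V].
  have [/existsP[e /and3P[h1 h2 h3]]|/existsPn H'] :=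
    boolP [exists e, [&& e \in O, e.1 \notin V & (phi e).1 \in V]]; first by exists e.
  have [e0 e0O e0V] : exists2 e0, e0 \in O & e0.1 \notin V.
    apply/exists_inP; apply: contraLR vK => /exists_inPn H2; rewrite -leqNgt.
    apply/subset_leq_card/subsetP => e eO; rewrite inE eO /=.
    by have := H2 e eO; rewrite negbK.
  have all i : (iter i phi e0).1 \notin V.
    elim: i => // i IH; have := H' (iter i phi e0); rewrite IH iterS /= => /nandP[|//].
    by rewrite -(Oeq e0 e0O) iter_porbit_phi.
  move: vn0; rewrite /nV => /card_gt0P[f]; rewrite inE => /andP[].
  by rewrite -(Oeq e0 e0O) => /in_porbit[i ->] fV; have := all i; rewrite fV.
have sub : (#|[set e in O | e.1 \in V]| + 1 + #|O :&: M| <= #|O|)%N.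
  have d1 : [disjoint [set e in O | e.1 \in V] & e |: (O :&: M)].
    apply/pred0P => f /=; rewrite !inE; apply/negP => /andP[/andP[fO fV]].
    case/orP => [/eqP E|/andP[_ /MP[_ _ _ fV' _]]]; last by rewrite fV in fV'.
    by move: fV; rewrite E (negbTE eV).
  have ne : e \notin O :&: M.
    rewrite inE negb_and; apply/orP; right; apply/negP => /MP[_ _ _ _].
    by rewrite -(phi_fst pos (OH _ eO)) eV'.
  have := cardsUI [set e in O | e.1 \in V] (e |: (O :&: M)).
  move: d1; rewrite -setI_eq0 => /eqP ->; rewrite cards0 cardsU1 ne addn0 -addnA => <-.
  apply/subset_leq_card/subsetP => f; rewrite !inE => /orP[/andP[]//|/orP[/eqP->//|/andP[]//]].
have DM : #|O| = (#|O :&: M| + #|O :\: M|)%N by rewrite cardsID.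
have [k4|k3] := leqP 4 #|O|; first by move: sub DM vn0; rewrite -/nV; lia.
have k3' : #|O| = 3%N by apply/eqP; rewrite eqn_leq K3 -ltnS k3.
have [v2|v1] := leqP 2 nV; first by move: sub DM v2; rewrite -/nV; lia.
have -> : O :\: M = O.
  apply/setDidPl/pred0P => f /=; apply/negP => /andP[fO /MP[_ _ n3 _ _]]; case/eqP: n3.
  by rewrite -k3' Ocard.
(* A triangle with one vertex has 6 + 3 + 2 = 11; the request it sends out brings the missing
   unit. *)
suff : (0 < \sum_(e in O) tri e)%N by move: k3' vn0; lia.
have O3 f : f \in O -> iter 3 phi f = f by rewrite -k3'; apply: Ocard.
have pO := Ophi _ eO; have ppO := Ophi _ pO.
have uniqV f f' : f \in O -> f' \in O -> f.1 \in V -> f'.1 \in V -> f = f'.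
  move=> h1 h2 h3 h4; have := v1; rewrite ltnS => /card_le1_eqP; apply; by rewrite inE ?h1 ?h2.
have npp : (phi (phi e)).1 \notin V.
  apply/negP => ppV; have E := uniqV _ _ ppO pO ppV eV'.
  by have := phi_neq pH (OH _ pO); rewrite E eqxx.
have t : tri (phi (phi e)).
  rewrite /tri OH ?O3 // eqxx /=; have e3 := O3 _ eO; rewrite /= in e3.
  by rewrite e3 eV eV' npp.
by rewrite (bigD1 (phi (phi e))) //= t.
Qed.

(** Payments and receipts cancel in the total of [g], because [exit] is a bijection from the [tri]
    darts onto [M]. *)
Lemma faces_bound :
  (12 * nfaces pH + 9 * #|H| <= 12 * #|{: P * P}| + 2 * #|[set d in H | d.1 \in V]|)%N.
Proof.
have le : (12 * nfaces pH <= \sum_d g d)%N.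
  apply: leq_sum_porbits => d; have [dH|dH] := boolP (d \in H); first exact: face_charge.
  by rewrite (bigD1 d) ?porbit_id //= /g (negbTE dH) leq_addr.
have tH b : tri b -> b \in H by case/and5P.
have MH d : d \in M -> d \in H by case/MP.
have count (p : pred (P * P)) : (forall d, p d -> d \in H) -> (\sum_(d in H) p d = #|[set d | p d]|)%N.
  move=> pH'; rewrite -sum1_card [LHS]big_mkcond [RHS]big_mkcond; apply: eq_bigr => d _.
  by rewrite inE; have := pH' d; case: (p d) => [->//|_]; case: ifP.
have E : (\sum_d g d + #|M| = 12 * #|~: H| + 3 * #|H| + 2 * #|[set d in H | d.1 \in V]| + #|[set b | tri b]|)%N.
  rewrite (bigID (mem H)) /=.
  have -> : (\sum_(d | d \notin H) g d = 12 * #|~: H|)%N.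
    rewrite mulnC -sum_nat_const; apply: congr_big => // d; rewrite ?inE //.
    by move=> dH; rewrite /g (negbTE dH).
  have -> : (\sum_(d in H) g d = \sum_(d in H) (2 + (d \notin M) + 2 * (d.1 \in V) + tri d))%N.
    by apply: eq_bigr => d dH; rewrite /g dH.
  rewrite 3!big_split /= sum_nat_const (count tri tH).
  have -> : (\sum_(d in H) 2 * (d.1 \in V) = 2 * #|[set d in H | d.1 \in V]|)%N.
    rewrite -big_distrr; congr muln.
    rewrite -sum1_card [LHS]big_mkcond [RHS]big_mkcond; apply: eq_bigr => d _.
    by rewrite inE; case: (d \in H); case: (d.1 \in V).
  have : (\sum_(d in H) (d \notin M) + #|M| = #|H|)%N.
    have -> : #|M| = (\sum_(d in H) (d \in M))%N.
      by rewrite (count (mem M) MH); apply: eq_card => d; rewrite inE.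
    rewrite -big_split /= -sum1_card; apply: eq_bigr => d _.
    by case: (d \in M).
  move: (\sum_(d in H) (d \notin M))%N #|M| #|H| #|~: H| #|[set d in H | d.1 \in V]| #|[set d | tri d]|.
  move=> a b c d e f; lia.
have cM : #|M| = #|[set b | tri b]| by rewrite card_in_imset.
have cH : (#|{: P * P}| = #|H| + #|~: H|)%N by rewrite cardsC.
move: le E; rewrite cM cH; lia.
Qed.

End Discharging.

(** * Wide angles *)

Section Angles.
Variable R : realType.
Implicit Types (u v w : R * R) (c t : R).

(** For [0 <= c] and nonzero vectors: the cosine of their angle is at most [c] in absolute value.
    Squaring removes the norms and the orientations of the two lines. *)
Definition wide c u v := dotp u v ^+ 2 <= c ^+ 2 * (dotp u u * dotp v v).

Lemma wideC c u v : wide c u v = wide c v u.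
Proof. by rewrite /wide /dotp [u.1 * v.1]mulrC [u.2 * v.2]mulrC [_ * (v.1 * _ + _)]mulrC. Qed.

Lemma wide_scale c k u v : k != 0 ->
  wide c (k * u.1, k * u.2) v = wide c u v.
Proof.
move=> k0; have k2 : 0 < k ^+ 2 by rewrite lt_neqAle sqr_ge0 eq_sym sqrf_eq0 k0.
rewrite /wide /dotp /= -(ler_pM2l k2 ((u.1 * v.1 + u.2 * v.2) ^+ 2)).
by congr (_ <= _); ring.
Qed.

Lemma wide_rot90 c u w : wide c u w -> wide c w (oppv u).
Proof.
move=> h; have -> : oppv u = (-1 * u.1, -1 * u.2) by rewrite /oppv !mulN1r.
by rewrite wideC wide_scale // oppr_eq0 oner_eq0.
Qed.

Lemma dotp_gt0 u : nzv u -> 0 < dotp u u.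
Proof.
rewrite /nzv /dotp -!expr2 => n.
by rewrite lt_neqAle addr_ge0 ?sqr_ge0 // andbT eq_sym paddr_eq0 ?sqr_ge0 // !sqrf_eq0 negb_and.
Qed.

Lemma lagrange u v : cross u v ^+ 2 = dotp u u * dotp v v - dotp u v ^+ 2.
Proof. by rewrite /cross /dotp; ring. Qed.

Lemma wide_cross c u v : 0 <= c < 1 -> nzv u -> nzv v -> wide c u v -> cross u v != 0.
Proof.
move=> /andP[c0 c1] /dotp_gt0 nu /dotp_gt0 nv h; rewrite -sqrf_eq0 lagrange gt_eqF // subr_gt0.
apply: (le_lt_trans h); rewrite gtr_pMl ?mulr_gt0 //.
by rewrite -[ltRHS](expr1n _ 2) ltr_pXn2r ?nnegrE.
Qed.

(* The Gram determinant of three plane vectors vanishes, but it would be positive here. *)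
Lemma three_wide c u v w : 0 <= c < 2^-1 -> nzv u -> nzv v -> nzv w ->
  wide c u v -> wide c v w -> wide c w u -> False.
Proof.
move=> /andP[c0 c1] /dotp_gt0 + /dotp_gt0 + /dotp_gt0; rewrite /wide.
have : dotp u u * dotp v v * dotp w w + 2 * (dotp u v * dotp v w * dotp w u) =
   dotp u u * dotp v w ^+ 2 + dotp v v * dotp w u ^+ 2 + dotp w w * dotp u v ^+ 2.
  by rewrite /dotp; ring.
move: (dotp u u) (dotp v v) (dotp w w) (dotp u v) (dotp v w) (dotp w u) => A B C p q r.
move=> gram A0 B0 C0 h1 h2 h3.
have c2 : c ^+ 2 < 4^-1.
  have -> : 4^-1 = (2^-1 : R) ^+ 2 by field.
  by rewrite ltr_pXn2r ?nnegrE // invr_ge0.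
(* For unit vectors with pairwise cosines 1/2 in absolute value the Gram determinant is at least 1 -
   3/4 - 2/8 = 0; strictly smaller cosines make it positive. *)
have e1 : C * p ^+ 2 < (A * B * C) / 4.
  have : C * p ^+ 2 <= C * (c ^+ 2 * (A * B)) by rewrite ler_pM2l.
  have : c ^+ 2 * (A * B * C) < 4^-1 * (A * B * C) by rewrite ltr_pM2r ?mulr_gt0.
  lra.
have e2 : A * q ^+ 2 < (A * B * C) / 4.
  have : A * q ^+ 2 <= A * (c ^+ 2 * (B * C)) by rewrite ler_pM2l.
  have : c ^+ 2 * (A * B * C) < 4^-1 * (A * B * C) by rewrite ltr_pM2r ?mulr_gt0.
  lra.
have e3 : B * r ^+ 2 < (A * B * C) / 4.
  have : B * r ^+ 2 <= B * (c ^+ 2 * (C * A)) by rewrite ler_pM2l.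
  have : c ^+ 2 * (A * B * C) < 4^-1 * (A * B * C) by rewrite ltr_pM2r ?mulr_gt0.
  lra.
have N0 : 0 < A * B * C by rewrite !mulr_gt0.
have e4 : (p * q * r) ^+ 2 <= ((A * B * C) / 8) ^+ 2.
  have -> : (p * q * r) ^+ 2 = (C * p ^+ 2) * (A * q ^+ 2) * (B * r ^+ 2) / (A * B * C).
    by field; rewrite !gt_eqF.
  have -> : (A * B * C / 8) ^+ 2 = (A * B * C / 4) * (A * B * C / 4) * (A * B * C / 4) / (A * B * C).
    by field; rewrite !gt_eqF.
  rewrite ler_pM2r ?invr_gt0 //.
  have f1 : 0 <= C * p ^+ 2 by rewrite mulr_ge0 ?sqr_ge0 // ltW.
  have f2 : 0 <= A * q ^+ 2 by rewrite mulr_ge0 ?sqr_ge0 // ltW.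
  have f3 : 0 <= B * r ^+ 2 by rewrite mulr_ge0 ?sqr_ge0 // ltW.
  apply: ler_pM => //; [exact: mulr_ge0 | apply: ler_pM => // | ]; exact: ltW.
have e5 : - (A * B * C / 8) <= p * q * r.
  rewrite -lerNl; apply: le_trans (ler_norm _) _; rewrite normrN.
  by rewrite -(@ler_pXn2r _ 2) ?nnegrE // ?real_normK ?num_real //; lra.
lra.
Qed.

(** Lengths and signs are absorbed in [k], so that turns simply add up; returning to the initial
    direction still forces [sin t = 0]. *)
Definition rot u v t := exists2 k, k != 0 &
  v = (k * (cos t * u.1 - sin t * u.2), k * (cos t * u.2 + sin t * u.1)).

Lemma rot_trans u v w s t : rot u v s -> rot v w t -> rot u w (s + t).
Proof.
case=> k k0 -> [l l0 ->]; exists (l * k); first by rewrite mulf_neq0.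
by rewrite sinD cosD /=; congr pair; ring.
Qed.

Lemma rot_self u t : nzv u -> rot u u t -> sin t = 0.
Proof.
move=> /dotp_gt0 nu [k k0 E]; apply/eqP.
have : k * sin t * dotp u u == 0.
  have e1 := congr1 fst E; have e2 := congr1 snd E; rewrite /= in e1 e2.
  have -> : k * sin t * dotp u u = (k * (cos t * u.2 + sin t * u.1)) * u.1 - (k * (cos t * u.1 - sin t * u.2)) * u.2.
    by rewrite /dotp; ring.
  by rewrite -e1 -e2; apply/eqP; ring.
by rewrite !mulf_eq0 (negbTE k0) (gt_eqF nu) orbF.
Qed.

Lemma wide_rot alpha u v : 0 <= alpha <= pi / 2 -> nzv u -> nzv v ->
  0 < cross u v -> wide (cos alpha) u v ->
  exists2 t, alpha <= t <= pi - alpha & rot u v t.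
Proof.
move=> /andP[a0 a1] /dotp_gt0 nu /dotp_gt0 nv cuv h.
have pi0 := pi_gt0 R.
set n := Num.sqrt (dotp u u * dotp v v).
have n0 : 0 < n by rewrite sqrtr_gt0 mulr_gt0.
have n2 : n ^+ 2 = dotp u u * dotp v v by rewrite sqr_sqrtr // mulr_ge0 // ltW.
have ca : 0 <= cos alpha by rewrite cos_ge0_pihalf // a1 andbT; lra.
set r := dotp u v / n.
have r2 : r ^+ 2 <= cos alpha ^+ 2.
  by rewrite /r expr_div_n n2 ler_pdivrMr ?mulr_gt0.
have /andP[r_lo r_hi] : - cos alpha <= r <= cos alpha.
  rewrite -ler_norml -(@ler_pXn2r _ 2) ?nnegrE //.
  by rewrite real_normK ?num_real.
have r1 : -1 <= r <= 1.
  by have := cos_le1 alpha => c1; apply/andP; split; lra.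
have ct : cos (acos r) = r by rewrite acosK // in_itv.
have t0 := acos_ge0 r1; have tpi := acos_lepi r1.
have st : sin (acos r) = cross u v / n.
  rewrite sin_acos // -[RHS]gtr0_norm ?divr_gt0 // -sqrtr_sqr; congr Num.sqrt.
  by rewrite /r !expr_div_n lagrange n2; field; rewrite !gt_eqF.
exists (acos r).
  rewrite leNgt; apply/andP; split.
    apply/negP => lt; have : cos alpha < cos (acos r).
      by rewrite ltr_cos // in_itv /= ?t0 ?tpi ?a0 //=; lra.
    by rewrite ct ltNge r_hi.
  rewrite leNgt; apply/negP => lt; have : cos (acos r) < cos (pi - alpha).
    by rewrite ltr_cos // in_itv /= ?t0 ?tpi //=; lra.
  by rewrite ct cosB cospi sinpi mul0r addr0 mulN1r ltNge r_lo.
exists (n / dotp u u); first by rewrite mulf_neq0 ?invr_neq0 ?gt_eqF.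
rewrite ct st /r; have ne : n != 0 by rewrite gt_eqF.
have du : dotp u u != 0 by rewrite gt_eqF.
rewrite [LHS]surjective_pairing; congr pair; apply: (mulfI du).
  transitivity (dotp u v * u.1 - cross u v * u.2).
    by rewrite /dotp /cross; ring.
  by field; rewrite ne du.
transitivity (dotp u v * u.2 + cross u v * u.1).
  by rewrite /dotp /cross; ring.
by field; rewrite ne du.
Qed.

Lemma cos_pi3 : cos (pi / 3) = 2^-1 :> R.
Proof.
have pi0 := pi_gt0 R.
have c0 : 0 < cos (pi / 3 : R) by rewrite cos_gt0_pihalf //; apply/andP; split; lra.
have : cos (pi / 3 + (pi / 3 + pi / 3)) = -1 :> R.
  by rewrite -cospi; congr cos; field.
rewrite !cosD sinD.
have := cos2Dsin2 (pi / 3 : R); move: c0; move: (cos _) (sin _) => x y x0 e1 e2.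
(* The triple angle equation [4 x^3 - 3 x = -1] has the roots -1 and, twice, 1/2. *)
have e3 : (x + 1) * (2 * x - 1) ^+ 2 = 0.
  have y2 : y ^+ 2 = 1 - x ^+ 2 by lra.
  have e2' : x ^+ 3 - 3 * x * y ^+ 2 = -1 by rewrite -e2; ring.
  move: e2'; rewrite y2 => e2'.
  have -> : (x + 1) * (2 * x - 1) ^+ 2 = (x ^+ 3 - 3 * x * (1 - x ^+ 2)) + 1 by ring.
  by rewrite e2'; ring.
move/eqP: e3; rewrite mulf_eq0 sqrf_eq0 gt_eqF /=; last by lra.
by move/eqP => e; lra.
Qed.

Lemma cos_lt_half alpha : 2 * pi / 5 < alpha -> alpha <= pi / 2 -> cos alpha < 2^-1 :> R.
Proof.
move=> h1 h2; have pi0 := pi_gt0 R.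
by rewrite -cos_pi3 ltr_cos ?in_itv /=; try (apply/andP; split); lra.
Qed.

(** The total turn lies strictly between 6 pi / 5 and 9 pi / 5 for three corners and between 2 pi
    and 3 pi for five; neither interval contains a multiple of pi. *)
Lemma turn_not_closed alpha t (n : nat) : 2 * pi / 5 < alpha -> (n == 3) || (n == 5) ->
  n%:R * alpha <= t <= n%:R * (pi - alpha) -> sin t != 0.
Proof.
move=> ha hn /andP[h1 h2]; have pi0 := pi_gt0 R; apply/eqP => s0.
case/orP: hn => /eqP En; subst n.
  have : 0 < sin (t - pi) by rewrite sin_gt0_pi //; apply/andP; split; lra.
  by rewrite sinB s0 sinpi mul0r mulr0 subr0 ltxx.
have : 0 < sin (t - pi - pi) by rewrite sin_gt0_pi //; apply/andP; split; lra.
by rewrite !sinB s0 sinpi !(mul0r, mulr0, subr0) ltxx.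
Qed.

End Angles.

(** * Crossing points of degree four and the turning of faces *)

Section Star.
Variables (R : realType) (P : finType) (pos : P -> R * R).
Hypothesis pos_inj : injective pos.
Variable S : {set P * P}.
Hypothesis pS : plane pos S.

Local Notation dir := (dir pos).
Local Notation rn := (rnext pos S).

Lemma rnext_fixed p q r : (p, q) \in S -> rn p q = q -> (p, r) \in S -> r = q.
Proof.
move=> pq E pr; have := @index_next _ (nbrs pos S p) q (nbrs_uniq _ _ _); rewrite (mem_nbrs pS) => /(_ pq).
rewrite -/(rnext pos S p q) E => i.
have qn : q \in nbrs pos S p by rewrite (mem_nbrs pS).
have rn' : r \in nbrs pos S p by rewrite (mem_nbrs pS).
have := rn'; have := qn; rewrite -!index_mem => h1 h2.
have e : index r (nbrs pos S p) = index q (nbrs pos S p) by move: i; case: (_.+1 =P _); lia.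
by rewrite -(nth_index q rn') e nth_index.
Qed.

Definition posm (v u : R * R) := exists2 k : R, 0 < k & v = (k * u.1, k * u.2).

(* p is a crossing point: its neighbours a, b, c, d lie, in counterclockwise order,
   on two lines with directions u and w. *)
Definition star p a b c d (u w : R * R) :=
  [/\ 0 < cross u w, [/\ (p, a) \in S, (p, b) \in S, (p, c) \in S & (p, d) \in S],
      forall q, (p, q) \in S -> q \in [:: a; b; c; d] &
      [/\ posm (dir p a) u, posm (dir p b) w, posm (dir p c) (oppv u) & posm (dir p d) (oppv w)]].

Lemma star_rot p a b c d u w : star p a b c d u w -> star p b c d a w (oppv u).
Proof.
case=> [c0 [pa pb pc pd] H [ka kb kc kd]]; split=> //.
- by rewrite crossNr crossC opprK.
- by move=> q /H; rewrite !inE orbC -!orbA.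
- by rewrite oppvK.
Qed.

Lemma posm_cross v v' u w : posm v u -> posm v' w ->
  exists2 k, 0 < k & cross v v' = k * cross u w.
Proof.
case=> k k0 -> [k' k'0 ->]; exists (k * k'); first exact: mulr_gt0.
by rewrite /cross /=; ring.
Qed.

Lemma star_cross p a b c d u w : star p a b c d u w -> 0 < cross (dir p a) (dir p b).
Proof.
by case=> [c0 _ _ [ka kb _ _]]; have [k k0 ->] := posm_cross ka kb; rewrite mulr_gt0.
Qed.

Lemma star_rnext p a b c d u w : star p a b c d u w -> rn p a = b.
Proof.
move=> st; have c0 := star_cross st; case: st => [c1 [pa pb pc pd] H [ka kb kc kd]].
apply: (rnext_eq pos_inj pS) => // e /H; rewrite !inE => /or4P[] /eqP -> c2 c3.
- by rewrite crossxx ltxx in c2.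
- by rewrite crossxx ltxx in c3.
- move: c2; have [k _ ->] := posm_cross ka kc.
  by rewrite crossNr crossxx oppr0 mulr0 ltxx.
- move: c3; have [k _ ->] := posm_cross kd kb.
  by rewrite crossNl crossxx oppr0 mulr0 ltxx.
Qed.

Lemma star_opposite p a b c d u w : star p a b c d u w ->
  betw (pos p) (pos a) (pos (rn p (rn p a))).
Proof.
move=> st; rewrite (star_rnext st) (star_rnext (star_rot st)).
case: st => [c0 _ _ [[k k0 ka] _ [l l0 kc] _]]; rewrite /betw -/(dir p a) -/(dir p c) ka kc.
apply/andP; split; first by apply/eqP; rewrite /cross /=; ring.
have -> : dotp (k * u.1, k * u.2) (l * (oppv u).1, l * (oppv u).2) = - (k * l * dotp u u).
  by rewrite /dotp /=; ring.
rewrite oppr_lt0 !mulr_gt0 // dotp_gt0 //.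
by apply: contraTT c0; rewrite /nzv negb_or !negbK => /andP[/eqP h1 /eqP h2]; rewrite /cross h1 h2 !mul0r subr0 ltxx.
Qed.

Lemma star_uniq p a b c d u w : star p a b c d u w -> uniq [:: a; b; c; d].
Proof.
move=> st; have c1 := star_cross st; have st2 := star_rot st; have c2 := star_cross st2.
have st3 := star_rot st2; have c3 := star_cross st3.
have st4 := star_rot st3; have c4 := star_cross st4.
have ne x y : 0 < cross (dir p x) (dir p y) -> x != y.
  by apply: contraTneq => ->; rewrite crossxx ltxx.
have ne2 x y z : 0 < cross (dir p x) (dir p y) -> 0 < cross (dir p y) (dir p z) -> x != z.
  move=> h1; apply: contraTneq => <-; rewrite crossC oppr_gt0 -leNgt; exact: ltW.
rewrite /= !inE !negb_or (eq_sym a d) (ne _ _ c1) (ne _ _ c2) (ne _ _ c3) (ne _ _ c4).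
by rewrite (ne2 _ _ _ c1 c2) (ne2 _ _ _ c2 c3).
Qed.

Lemma star_wide p a b c d u w k : star p a b c d u w -> wide k u w ->
  wide k (dir p a) (dir p (rn p a)).
Proof.
move=> st; rewrite (star_rnext st); case: st => [_ _ _ [[l l0 ->] [m m0 ->] _ _]].
have l1 : l != 0 by rewrite gt_eqF.
have m1 : m != 0 by rewrite gt_eqF.
by move=> h; rewrite (wide_scale _ _ _ l1) wideC (wide_scale _ _ _ m1) wideC.
Qed.

Variable V : {set P}.
Variable alpha : R.
Hypothesis alpha_lo : 2 * pi / 5 < alpha.
Hypothesis alpha_hi : alpha <= pi / 2.
Hypothesis corner_pos : forall x y, x \notin V -> (x, y) \in S ->
  0 < orient (pos x) (pos y) (pos (rn x y)).
Hypothesis corner_wide : forall x y, x \notin V -> (x, y) \in S ->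
  wide (cos alpha) (dir x y) (dir x (rn x y)).

Local Notation phi := (phi pos S).

(** At a crossing the corners are convex and wide, so each step along the face is a left turn by an
    angle in [alpha, pi - alpha]. *)
Lemma face_turn d n : d \in S -> (forall i, (iter i phi d).1 \notin V) ->
  exists2 t, n%:R * alpha <= t <= n%:R * (pi - alpha) &
    rot (dir d.1 d.2) (dir (iter n phi d).1 (iter n phi d).2) t.
Proof.
move=> dS dV; elim: n => [|n [t /andP[t1 t2] rt]].
  exists 0; first by rewrite !mul0r lexx.
  exists 1; first exact: oner_neq0.
  by rewrite cos0 sin0 [LHS]surjective_pairing; congr pair; ring.
have itS i : iter i phi d \in S by elim: i => // i IH; rewrite iterS phi_mem.
have := dV n.+1; have := itS n.+1; move: rt; rewrite iterS.
have := itS n; case: (iter n phi d) => x y xy rt yzS yV.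
have E : phi (x, y) = (y, (phi (x, y)).2) by rewrite [LHS]surjective_pairing phi_fst.
rewrite E in yzS yV *; rewrite /= in rt yV *; set z := (phi (x, y)).2 in E yzS *.
have rz : rn y z = x := phi_rnext xy E.
have cw := corner_wide yV yzS; have cp := corner_pos yV yzS; rewrite rz in cw cp.
have [|||||s /andP[s1 s2] rs] := @wide_rot _ alpha (dir x y) (dir y z).
- by rewrite alpha_hi andbT; have := pi_gt0 R; have := alpha_lo; lra.
- exact: (plane_nzv pos_inj pS).
- exact: (plane_nzv pos_inj pS).
- by move: cp; rewrite /orient /cross /dir /vec /=; lra.
- have -> : dir x y = (-1 * (dir y x).1, -1 * (dir y x).2).
    by rewrite /dir /vec /=; congr pair; ring.
  by rewrite wide_scale ?oppr_eq0 ?oner_eq0 // wideC.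
exists (t + s); last exact: rot_trans rs.
by rewrite -[n.+1]addn1 natrD !mulrDl !mul1r; apply/andP; split; apply: lerD.
Qed.

Lemma no_tri_pent d : d \in S -> (forall i, (iter i phi d).1 \notin V) ->
  iter 3 phi d != d /\ iter 5 phi d != d.
Proof.
move=> dS dV; have nz : nzv (dir d.1 d.2) by case: (d) dS => x y; apply: plane_nzv.
have aux n : (n == 3) || (n == 5) -> iter n phi d != d.
  move=> hn; apply/eqP => E; have [t ht] := face_turn n dS dV; rewrite E => /(rot_self nz).
  exact/eqP/(turn_not_closed alpha_lo hn).
by split; apply: aux.
Qed.

End Star.

(** * Planarization *)

Section ClosedSegments.
Variable R : realFieldType.
Implicit Types (a b p q s : R * R) (t : R).

Definition onseg a b s := (cross (vec s a) (vec s b) == 0) && (dotp (vec s a) (vec s b) <= 0).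

Lemma at0 a b : at_ a b 0 = a.
Proof. by case: a => x y; rewrite /at_ /= !mul0r !addr0. Qed.
Lemma at1 a b : at_ a b 1 = b.
Proof. by case: b => x y; rewrite /at_ /= !mul1r !subrKC. Qed.

Lemma vec0 a b : ~~ nzv (vec a b) -> a = b.
Proof.
rewrite /nzv negb_or !negbK /vec /= !subr_eq0 => /andP[/eqP h1 /eqP h2].
by rewrite [a]surjective_pairing -h1 -h2 -surjective_pairing.
Qed.

Lemma onseg_at a b s : onseg a b s -> exists2 t, 0 <= t <= 1 & s = at_ a b t.
Proof.
move=> /andP[c]; rewrite le_eqVlt => /orP[d|d]; last first.
  have [|t /andP[t0 t1] ->] := @betw_at _ s a b; first by rewrite /betw c d.
  by exists t; rewrite // !ltW.
have : (dotp (vec s a) (vec s a)) * (dotp (vec s b) (vec s b)) == 0.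
  have -> : (dotp (vec s a) (vec s a)) * (dotp (vec s b) (vec s b)) =
    cross (vec s a) (vec s b) ^+ 2 + dotp (vec s a) (vec s b) ^+ 2.
    by rewrite /cross /dotp; ring.
  by rewrite (eqP c) (eqP d) expr0n addr0.
rewrite mulf_eq0 /dotp -!expr2 !paddr_eq0 ?sqr_ge0 // !sqrf_eq0.
have sq (e : R * R) : (e.1 == 0) && (e.2 == 0) = ~~ nzv e by rewrite negb_or !negbK.
rewrite !sq => /orP[|] /vec0 ->.
  by exists 0; rewrite ?at0 ?lexx ?ler01.
by exists 1; rewrite ?at1 ?lexx ?ler01.
Qed.

Lemma at_onseg a b t : 0 <= t <= 1 -> onseg a b (at_ a b t).
Proof.
move=> /andP[t0 t1]; apply/andP; split; first by apply/eqP; rewrite /cross /vec /at_ /=; ring.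
have -> : dotp (vec (at_ a b t) a) (vec (at_ a b t) b) = - (t * (1 - t) * dotp (vec a b) (vec a b)).
  by rewrite /dotp /vec /at_ /=; ring.
rewrite oppr_le0 !mulr_ge0 ?subr_ge0 //.
by rewrite /dotp -!expr2 addr_ge0 ?sqr_ge0.
Qed.

Lemma at_at a b t1 t2 t : at_ (at_ a b t1) (at_ a b t2) t = at_ a b ((1 - t) * t1 + t * t2).
Proof. by rewrite /at_ /=; congr pair; ring. Qed.

Lemma onseg_sym a b s : onseg a b s = onseg b a s.
Proof.
rewrite /onseg [cross (vec s a) _]crossC oppr_eq0 /dotp.
by rewrite ![_ * (vec s b).1]mulrC ![_ * (vec s b).2]mulrC.
Qed.

Lemma onseg_l a b : onseg a b a.
Proof. by rewrite -{2}(at0 a b) at_onseg // lexx ler01. Qed.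
Lemma onseg_r a b : onseg a b b.
Proof. by rewrite onseg_sym onseg_l. Qed.

Lemma onseg_convex a b p q t : onseg a b p -> onseg a b q -> 0 <= t <= 1 ->
  onseg a b (at_ p q t).
Proof.
move=> /onseg_at[t1 /andP[h1 h2] ->] /onseg_at[t2 /andP[h3 h4] ->] /andP[h5 h6].
rewrite at_at at_onseg //; apply/andP; split; first by rewrite addr_ge0 ?mulr_ge0 ?subr_ge0.
rewrite -subr_ge0.
have -> : 1 - ((1 - t) * t1 + t * t2) = (1 - t) * (1 - t1) + t * (1 - t2) by ring.
by rewrite addr_ge0 ?mulr_ge0 ?subr_ge0.
Qed.

Lemma onseg_vec a b p q : onseg a b p -> onseg a b q -> cross (vec a b) (vec p q) = 0.
Proof. by move=> /onseg_at[t _ ->] /onseg_at[s _ ->]; rewrite /cross /vec /at_ /=; ring. Qed.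

Lemma onseg_orient a b p q r : onseg a b p -> onseg a b q -> onseg a b r ->
  orient p q r = 0.
Proof.
move=> /onseg_at[t _ ->] /onseg_at[s _ ->] /onseg_at[u _ ->].
by rewrite /orient /cross /vec /at_ /=; ring.
Qed.

Lemma onseg_split a b p q : onseg a b p -> onseg a b q -> onseg p b q \/ onseg p a q.
Proof.
move=> /onseg_at[t /andP[h1 h2] ->] /onseg_at[s /andP[h3 h4] ->].
have [ts|/ltW st] := leP t s.
  left; have [e|ne] := eqVneq t 1.
    have -> : s = 1 by apply/eqP; rewrite eq_le h4 -e.
    by rewrite at1 onseg_r.
  have lt : 0 < 1 - t by rewrite subr_gt0 lt_neqAle ne.
  have -> : at_ a b s = at_ (at_ a b t) b ((s - t) / (1 - t)).
    by rewrite -{3}(at1 a b) at_at; congr at_; field; rewrite gt_eqF.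
  apply: at_onseg; rewrite divr_ge0 ?subr_ge0 //= ler_pdivrMr // mul1r lerB //.
right; have [e|ne] := eqVneq t 0.
  have -> : s = 0 by apply/eqP; rewrite eq_le h3 -e st.
  by rewrite at0 onseg_r.
have lt : 0 < t by rewrite lt_neqAle eq_sym ne.
have -> : at_ a b s = at_ (at_ a b t) a (1 - s / t).
  by rewrite -{3}(at0 a b) at_at; congr at_; field; rewrite gt_eqF.
apply: at_onseg; rewrite subr_ge0 ler_pdivrMr // mul1r st /= gerBl divr_ge0 //.
Qed.

End ClosedSegments.

Section Planarization.
Variables (R : realType) (V0 : finType) (adj : rel V0) (ps : V0 -> R * R).
Hypothesis adjC : symmetric adj.
Hypothesis adjI : irreflexive adj.
Hypothesis ps_inj : injective ps.
Variable alpha : R.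
Hypothesis alpha_lo : 2 * pi / 5 < alpha.
Hypothesis alpha_hi : alpha <= pi / 2.

Local Notation on x y s := (onseg (ps x) (ps y) s).
Local Notation dv x y := (vec (ps x) (ps y)).

Hypothesis crossing_wide : forall x y z w s, adj x y -> adj z w ->
  [set x; y] != [set z; w] -> on x y s -> on z w s ->
  (forall v, v \in [set x; y] -> v \in [set z; w] -> s <> ps v) ->
  wide (cos alpha) (dv x y) (dv z w).
Hypothesis no_K2 : forall x y, adj x y ->
  (exists2 z, adj x z & z != y) \/ (exists2 z, adj y z & z != x).

Variables (P : finType) (pos : P -> R * R).
Hypothesis pos_inj : injective pos.
Hypothesis vertex_pt : forall x y, adj x y -> exists p, pos p = ps x.
Hypothesis pt_cases : forall p,
  (exists x y, adj x y /\ pos p = ps x) \/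
  (exists x y z w, [/\ adj x y, adj z w, [set x; y] != [set z; w],
     on x y (pos p) & on z w (pos p)]).
Hypothesis crossing_pt : forall x y z w s, adj x y -> adj z w ->
  [set x; y] != [set z; w] -> on x y s -> on z w s -> exists p, pos p = s.

Let cos_bounds : 0 <= cos alpha < 2^-1.
Proof.
rewrite cos_lt_half // andbT cos_ge0_pihalf // alpha_hi andbT.
by have := pi_gt0 R; have := alpha_lo; lra.
Qed.

Let adj_nzv x y : adj x y -> nzv (dv x y).
Proof.
by move=> xy; apply/negPn/negP => /vec0/ps_inj e; rewrite e adjI in xy.
Qed.

Let cos_lt1 : 0 <= cos alpha < 1.
Proof. by case/andP: cos_bounds => h0 h; rewrite h0 (lt_trans h) // invf_lt1 // ltr1n. Qed.

Let adj_set x y z w : adj x y -> [set x; y] = [set z; w] -> (x = z /\ y = w) \/ (x = w /\ y = z).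
Proof.
move=> xy /setP E; have nxy : x != y by apply: contraTneq xy => ->; rewrite adjI.
have := E x; have := E y; rewrite !inE !eqxx orbT /=.
by move=> /esym/orP[/eqP e1|/eqP e1] /esym/orP[/eqP e2|/eqP e2]; subst; rewrite ?eqxx // in nxy *; [right|left].
Qed.

(** Different edges with two common points would be parallel. A common point that is not a shared
    endpoint is a crossing at a wide angle, hence not parallel; so both points are shared endpoints
    and the edges agree. *)
Lemma edge_unique x y z w s s' : adj x y -> adj z w -> s != s' ->
  on x y s -> on z w s -> on x y s' -> on z w s' -> [set x; y] = [set z; w].
Proof.
move=> xy zw ss' h1 h2 h3 h4; apply/eqP/negPn/negP => ne.
have nz : nzv (vec s s') by apply/negPn/negP => /vec0/eqP; apply/negP.
have par : cross (dv x y) (dv z w) = 0.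
  have c1 := onseg_vec h1 h3; have c2 := onseg_vec h2 h4.
  move: nz c1 c2; rewrite /nzv /cross; move: (vec s s') (dv x y) (dv z w) => [a b] [u1 u2] [w1 w2] /=.
  move=> nz c1 c2.
  have e1 : a * (u1 * w2 - u2 * w1) = 0.
    have -> : a * (u1 * w2 - u2 * w1) = (w1 * (u1 * b - u2 * a)) - u1 * (w1 * b - w2 * a) by ring.
    by rewrite c1 c2 !mulr0 subr0.
  have e2 : b * (u1 * w2 - u2 * w1) = 0.
    have -> : b * (u1 * w2 - u2 * w1) = (w2 * (u1 * b - u2 * a)) - u2 * (w1 * b - w2 * a) by ring.
    by rewrite c1 c2 !mulr0 subr0.
  case/orP: nz => n0; [move/eqP: e1 | move/eqP: e2]; by rewrite mulf_eq0 (negbTE n0) => /eqP.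
have common q : on x y q -> on z w q ->
    exists v, [/\ v \in [set x; y], v \in [set z; w] & q = ps v].
  move=> q1 q2.
  have [/existsP[v /and3P[v1 v2 /eqP v3]]|/existsPn H] :=
    boolP [exists v, [&& v \in [set x; y], v \in [set z; w] & q == ps v]]; first by exists v.
  have : cross (dv x y) (dv z w) != 0.
    apply: (wide_cross cos_lt1); rewrite ?adj_nzv //.
    apply: (crossing_wide (s := q)) => // v v1 v2 /eqP v3.
    by have := H v; rewrite v1 v2 v3.
  by rewrite par eqxx.
have [v [v1 v2 sv]] := common s h1 h2; have [v' [v1' v2' sv']] := common s' h3 h4.
have vv' : v != v' by apply: contra ss' => /eqP e; rewrite sv sv' e.
case/eqP: ne; have nxy : x != y by apply: contraTneq xy => ->; rewrite adjI.
have nzw : z != w by apply: contraTneq zw => ->; rewrite adjI.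
have sub (A : {set V0}) : v \in A -> v' \in A -> #|A| = 2%N -> A = [set v; v'].
  move=> a1 a2 c; apply/esym/eqP; rewrite eqEcard c cards2 vv' andbT.
  by apply/subsetP => q; rewrite !inE => /orP[] /eqP ->.
by rewrite (sub _ v1 v1') ?cards2 ?nxy // (sub _ v2 v2') ?cards2 ?nzw.
Qed.

Definition planar_V := [set p | [exists x, [exists y, adj x y && (pos p == ps x)]]].
Definition planar_H := [set d | [&& d.1 != d.2,
  [exists x, [exists y, [&& adj x y, on x y (pos d.1) & on x y (pos d.2)]]] &
  [forall p, ~~ betw (pos p) (pos d.1) (pos d.2)]]].

Local Notation V := planar_V.
Local Notation H := planar_H.

Lemma VP p : reflect (exists x y, adj x y /\ pos p = ps x) (p \in V).
Proof.
rewrite inE; apply: (iffP existsP) => [[x /existsP[y /andP[h1 /eqP h2]]]|[x [y [h1 h2]]]].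
  by exists x, y.
by exists x; apply/existsP; exists y; rewrite h1 h2 eqxx.
Qed.

Lemma HP p q : reflect ((exists x y, [/\ adj x y, on x y (pos p) & on x y (pos q)]) /\
  visible pos p q) ((p, q) \in H).
Proof.
rewrite inE /= /visible; apply: (iffP and3P) => [[h1 /existsP[x /existsP[y /and3P[h2 h3 h4]]] h5]|].
  by split; [exists x, y | rewrite h1].
case=> [[x [y [h2 h3 h4]]] /andP[h1 h5]]; split=> //.
by apply/existsP; exists x; apply/existsP; exists y; rewrite h2 h3.
Qed.

(** A point where pieces of different edges cross belongs to the point set, and visibility forbids
    such a point inside a piece. *)
Lemma plane_H : plane pos H.
Proof.
apply/planeP; split.
- move=> p q /HP[[x [y [h1 h2 h3]]] v]; apply/HP; split; first by exists x, y.
  by rewrite visible_sym.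
- by move=> p q /HP[].
move=> p q p' q' /HP[[x [y [xy hp hq]]] v1] /HP[[z [w [zw hp' hq']]] v2].
apply/negP => cr; have [r [t [r01 t01 E]]] := pcross_at cr.
have r01' : 0 <= r <= 1 by case/andP: r01 => /ltW -> /ltW ->.
have t01' : 0 <= t <= 1 by case/andP: t01 => /ltW -> /ltW ->.
have [e|ne] := eqVneq [set x; y] [set z; w].
  have hp2 : on x y (pos p').
    by case: (adj_set xy e) => -[-> ->]; rewrite // onseg_sym.
  by case/andP: cr; rewrite (onseg_orient hp hq hp2) mul0r ltxx.
have [|m Em] := crossing_pt xy zw ne (onseg_convex hp hq r01') _.
  by rewrite E; apply: onseg_convex.
case/andP: v1 => npq /forallP/(_ m)/negP; apply; rewrite Em.
by apply: at_betw => //; apply: dir_nzv.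
Qed.

Lemma neighbor_towards p x y : adj x y -> on x y (pos p) -> pos p != ps y ->
  exists q, (p, q) \in H /\ exists2 s, 0 < s <= 1 & pos q = at_ (pos p) (ps y) s.
Proof.
move=> xy hp npy.
have [py Epy] : exists q, pos q = ps y by apply: (@vertex_pt y x); rewrite adjC.
pose Q := [pred q | (q != p) && onseg (pos p) (ps y) (pos q)].
have Qpy : Q py.
  rewrite /= Epy onseg_r andbT; apply: contra npy => /eqP <-.
  by rewrite Epy.
(* The scalar product with the direction of [ps y] orders the points on this segment, so the minimum
   is the nearest one. *)
case: (@arg_minP _ _ _ py Q (fun q => dotp (vec (pos p) (pos q)) (vec (pos p) (ps y))) Qpy).
move=> q /andP[qp hq] mn; exists q.
have [s /andP[s0 s1] Eq] := onseg_at hq.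
have s0' : 0 < s.
  rewrite lt_neqAle s0 andbT eq_sym; apply: contra qp => /eqP e.
  by rewrite e at0 in Eq; apply/eqP/pos_inj.
have nz : 0 < dotp (vec (pos p) (ps y)) (vec (pos p) (ps y)).
  by apply: dotp_gt0; apply/negPn/negP => /vec0/eqP; apply/negP.
split; last by exists s; rewrite ?s0'.
apply/HP; split.
  exists x, y; split=> //; rewrite Eq; apply: onseg_convex; rewrite ?onseg_r ?s0 //.
rewrite /visible eq_sym qp; apply/forallP => r; apply/negP => /betw_at[t /andP[t0 t1] Er].
have Er' : pos r = at_ (pos p) (ps y) (t * s).
  by rewrite Er Eq -{1}(at0 (pos p) (ps y)) at_at mulr0 add0r.
have dE u : dotp (vec (pos p) (at_ (pos p) (ps y) u)) (vec (pos p) (ps y)) =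
   u * dotp (vec (pos p) (ps y)) (vec (pos p) (ps y)).
  by rewrite /dotp /vec /at_ /=; ring.
have Qr : Q r.
  have ts01 : 0 <= t * s <= 1.
    by apply/andP; split; [apply: mulr_ge0 | apply: mulr_ile1] => //; exact: ltW.
  rewrite /= Er' at_onseg // andbT.
  apply/eqP => e; move: Er'; rewrite e => /(congr1 (fun z => dotp (vec (pos p) z) (vec (pos p) (ps y)))).
  rewrite dE => /eqP; rewrite (_ : dotp (vec (pos p) (pos p)) _ = 0); last by rewrite /dotp /vec /=; ring.
  by rewrite eq_sym !mulf_eq0 !gt_eqF.
have := mn r Qr; rewrite Er' Eq !dE leNgt => /negP; apply.
by rewrite ltr_pM2r // gtr_pMl.
Qed.

Lemma ray_unique p q q' z s s' : (p, q) \in H -> (p, q') \in H -> 0 < s -> 0 < s' ->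
  pos q = at_ (pos p) z s -> pos q' = at_ (pos p) z s' -> q = q'.
Proof.
move=> pq pq' s0 s0' E E'.
have aux a b u u' : (p, b) \in H -> 0 < u -> u < u' ->
    pos a = at_ (pos p) z u -> pos b = at_ (pos p) z u' -> False.
  move=> pb u0 uu' Ea Eb; have u'0 : 0 < u' := lt_trans u0 uu'.
  have /HP[_ /andP[npb /forallP/(_ a)/negP]] := pb; apply.
  have -> : pos a = at_ (pos p) (pos b) (u / u').
    rewrite Ea Eb -{2}(at0 (pos p) z) at_at mulr0 add0r mulrVK ?unitfE ?gt_eqF //.
  apply: at_betw; last exact: dir_nzv.
  by rewrite divr_gt0 //= ltr_pdivrMr // mul1r.
case: (ltgtP s s') => ss'; [case: (aux q q' s s') | case: (aux q' q s' s) |] => //.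
by apply: pos_inj; rewrite E E' ss'.
Qed.

Lemma towards_posm p q x y s : adj x y -> on x y (pos p) -> pos p != ps y -> 0 < s ->
  pos q = at_ (pos p) (ps y) s -> posm (dir pos p q) (dv x y).
Proof.
move=> xy /onseg_at[t /andP[t0 t1] Ep] npy s0 Eq.
have t1' : 0 < 1 - t.
  rewrite subr_gt0 lt_neqAle t1 andbT; apply: contra npy => /eqP e.
  by rewrite Ep e at1.
exists (s * (1 - t)); first exact: mulr_gt0.
by rewrite /dir Eq Ep /vec /at_ /=; congr pair; ring.
Qed.

Lemma dvN x y : dv y x = oppv (dv x y).
Proof. by rewrite /vec /oppv /=; congr pair; ring. Qed.

Lemma inner_pt p x y : p \notin V -> adj x y -> pos p != ps x.
Proof. by move=> pV xy; apply: contra pV => /eqP e; apply/VP; exists x, y. Qed.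

Lemma toward_unique p q q' z s : (p, q) \in H -> (p, q') \in H -> 0 < s ->
  pos q = at_ (pos p) z s -> onseg (pos p) z (pos q') -> q' = q.
Proof.
move=> pq pq' s0 E /onseg_at[s' /andP[s'0 _] E'].
apply: (ray_unique pq' pq _ s0 E' E); rewrite lt_neqAle s'0 andbT eq_sym.
apply/eqP => e; rewrite e at0 in E'; have := plane_neq plane_H pq'.
by rewrite (pos_inj E') eqxx.
Qed.

Lemma star_of p x y z w : p \notin V -> adj x y -> adj z w -> on x y (pos p) ->
  on z w (pos p) -> wide (cos alpha) (dv x y) (dv z w) -> 0 < cross (dv x y) (dv z w) ->
  exists a b c d, star pos H p a b c d (dv x y) (dv z w).
Proof.
move=> pV xy zw h1 h2 wd c0.
have yx : adj y x by rewrite adjC.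
have wz : adj w z by rewrite adjC.
have npx := inner_pt pV xy; have npy := inner_pt pV yx.
have npz := inner_pt pV zw; have npw := inner_pt pV wz.
have h1' : on y x (pos p) by rewrite onseg_sym.
have h2' : on w z (pos p) by rewrite onseg_sym.
have [a [pa [sa /andP[sa0 _] Ea]]] := neighbor_towards xy h1 npy.
have [b [pb [sb /andP[sb0 _] Eb]]] := neighbor_towards zw h2 npw.
have [c [pc [sc /andP[sc0 _] Ec]]] := neighbor_towards yx h1' npx.
have [d [pd [sd /andP[sd0 _] Ed]]] := neighbor_towards wz h2' npz.
exists a, b, c, d; split=> //; last first.
  split; [exact: towards_posm sa0 Ea | exact: towards_posm sb0 Eb | |].
    by rewrite -dvN; exact: towards_posm sc0 Ec.
  by rewrite -dvN; exact: towards_posm sd0 Ed.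
move=> q pq; have /HP[[e [f [ef hp hq]]] _] := pq.
have inner v u : adj v u -> forall s, s \in [set v; u] -> pos p <> ps s.
  move=> vu s; have uv : adj u v by rewrite adjC.
  by rewrite !inE => /orP[] /eqP ->; apply/eqP; [exact: inner_pt pV vu | exact: inner_pt pV uv].
have toP x' y' m n (sm sn : R) : adj x' y' -> on x' y' (pos p) -> [set e; f] = [set x'; y'] ->
    (p, m) \in H -> (p, n) \in H -> 0 < sm -> 0 < sn -> pos m = at_ (pos p) (ps y') sm ->
    pos n = at_ (pos p) (ps x') sn -> q = m \/ q = n.
  move=> xy' hp' Es pm pn sm0 sn0 Em En.
  have hq' : on x' y' (pos q) by case: (adj_set ef Es) => -[<- <-] //; rewrite onseg_sym.
  case: (onseg_split hp' hq') => hs; first by left; exact: toward_unique sm0 Em hs.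
  by right; exact: toward_unique sn0 En hs.
have [Es|n1] := eqVneq [set e; f] [set x; y].
  by case: (toP x y a c sa sc xy h1 Es pa pc sa0 sc0 Ea Ec) => ->; rewrite !inE eqxx ?orbT.
have [Es|n2] := eqVneq [set e; f] [set z; w].
  by case: (toP z w b d sb sd zw h2 Es pb pd sb0 sd0 Eb Ed) => ->; rewrite !inE eqxx ?orbT.
(* A third edge through [p] would give three pairwise wide directions. *)
case: (@three_wide _ _ (dv x y) (dv z w) (dv e f) cos_bounds); rewrite ?adj_nzv //.
  apply: (crossing_wide (s := pos p)) => //; first by rewrite eq_sym.
  by move=> v vz _; apply: inner vz.
apply: (crossing_wide (s := pos p)) => //.
by move=> v vz _; apply: inner vz.
Qed.

Lemma star_exists p : p \notin V ->
  exists a b c d u w, star pos H p a b c d u w /\ wide (cos alpha) u w.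
Proof.
move=> pV; case: (pt_cases p) => [h|[x [y [z [w [xy zw ne h1 h2]]]]]].
  by case/negP: pV; apply/VP.
have wd : wide (cos alpha) (dv x y) (dv z w).
  apply: (crossing_wide (s := pos p)) => // v; rewrite !inE => /orP[] /eqP -> _; apply/eqP.
    exact: inner_pt xy.
  by apply: (@inner_pt _ _ x) => //; rewrite adjC.
have c0 := wide_cross cos_lt1 (adj_nzv xy) (adj_nzv zw) wd.
case: (ltgtP (cross (dv x y) (dv z w)) 0) => cs; last by rewrite cs eqxx in c0.
  have wz : adj w z by rewrite adjC.
  have wd' : wide (cos alpha) (dv x y) (dv w z).
    by rewrite (dvN z w); apply: wide_rot90; rewrite wideC.
  have cs' : 0 < cross (dv x y) (dv w z) by rewrite (dvN z w) crossNr oppr_gt0.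
  have h2' : on w z (pos p) by rewrite onseg_sym.
  have [a [b [c [d st]]]] := star_of pV xy wz h1 h2' wd' cs'.
  by exists a, b, c, d, (dv x y), (dv w z).
have [a [b [c [d st]]]] := star_of pV xy zw h1 h2 wd cs.
by exists a, b, c, d, (dv x y), (dv z w).
Qed.

(** Any of the four neighbours can come first, since the star may be rotated: its directions pass
    from u, w to w, -u, and so on. *)
Lemma star_at p q : p \notin V -> (p, q) \in H ->
  exists b c d u w, star pos H p q b c d u w /\ wide (cos alpha) u w.
Proof.
move=> pV pq; have [a [b [c [d [u [w [st wd]]]]]]] := star_exists pV.
have [_ _ Hq _] := st; have := Hq q pq; rewrite !inE.
have st2 := star_rot st; have st3 := star_rot st2; have st4 := star_rot st3.
have wd2 := wide_rot90 wd; have wd3 := wide_rot90 wd2; have wd4 := wide_rot90 wd3.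
case/or4P => /eqP ->.
- by exists b, c, d, u, w.
- by exists c, d, a, w, (oppv u).
- by exists d, a, b, (oppv u), (oppv w).
- by exists a, b, c, (oppv w), (oppv (oppv u)).
Qed.

Local Notation rn := (rnext pos H).

Lemma H_opposite p q : p \notin V -> (p, q) \in H -> betw (pos p) (pos q) (pos (rn p (rn p q))).
Proof.
move=> pV pq; have [b [c [d [u [w [st _]]]]]] := star_at pV pq.
exact: (star_opposite pos_inj plane_H st).
Qed.

Lemma H_corner_pos p q : p \notin V -> (p, q) \in H -> 0 < orient (pos p) (pos q) (pos (rn p q)).
Proof.
move=> pV pq; have [b [c [d [u [w [st _]]]]]] := star_at pV pq.
by rewrite (star_rnext pos_inj plane_H st); exact: star_cross st.
Qed.

Lemma H_corner_wide p q : p \notin V -> (p, q) \in H ->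
  wide (cos alpha) (dir pos p q) (dir pos p (rn p q)).
Proof.
move=> pV pq; have [b [c [d [u [w [st wd]]]]]] := star_at pV pq.
exact: (star_wide pos_inj plane_H st wd).
Qed.

Lemma H_degree p : p \notin V -> #|[set q | (p, q) \in H]| = 4%N.
Proof.
move=> pV; have [a [b [c [d [u [w [st _]]]]]]] := star_exists pV.
have us := star_uniq st; have [_ [pa pb pc pd] Hq _] := st.
have -> : 4%N = size [:: a; b; c; d] by [].
rewrite -(card_uniqP us); apply: eq_card => q; rewrite inE.
apply/idP/idP; first exact: Hq.
by rewrite 4!in_cons in_nil orbF => /or4P[] /eqP ->.
Qed.

Lemma H_no_isolated p : exists q, (p, q) \in H.
Proof.
have step x y : adj x y -> on x y (pos p) -> exists q, (p, q) \in H.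
  move=> xy h; have [e|ne] := eqVneq (pos p) (ps y); last first.
    by have [q [pq _]] := neighbor_towards xy h ne; exists q.
  have yx : adj y x by rewrite adjC.
  have h' : on y x (pos p) by rewrite onseg_sym.
  have ne : pos p != ps x.
    by rewrite e; apply/eqP => /ps_inj e'; rewrite e' adjI in xy.
  by have [q [pq _]] := neighbor_towards yx h' ne; exists q.
case: (pt_cases p) => [[x [y [xy e]]]|[x [y [z [w [xy _ _ h _]]]]]]; apply: step xy _ => //.
by rewrite e onseg_l.
Qed.

(* An edge of the planarization that is a whole component would be an edge of the graph
   crossed by no other, both of whose ends have degree one. *)
Lemma H_no_digon d : d \in H -> phi pos H (phi pos H d) != d.
Proof.
case: d => p q pq; apply/eqP => E.
have qp := plane_sym plane_H pq.
have E1 : phi pos H (p, q) = (q, p).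
  have := phi_fst pos (phi_mem plane_H pq); rewrite E /= => e.
  by rewrite [LHS]surjective_pairing -e phi_fst.
rewrite E1 in E; have r1 := phi_rnext pq E1; have r2 := phi_rnext qp E.
have pV : p \in V.
  apply/negPn/negP => pV; have := H_corner_pos pV pq.
  by rewrite r2 /orient crossxx ltxx.
have qV : q \in V.
  apply/negPn/negP => qV; have := H_corner_pos qV qp.
  by rewrite r1 /orient crossxx ltxx.
have only_p r : (p, r) \in H -> r = q by exact: (rnext_fixed plane_H pq r2).
have only_q r : (q, r) \in H -> r = p by exact: (rnext_fixed plane_H qp r1).
have /HP[[x [y [xy hp hq]]] _] := pq.
have npq := plane_neq plane_H pq.
have yx : adj y x by rewrite adjC.
have nxy : ps x != ps y by apply/eqP => /ps_inj e; rewrite e adjI in xy.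
have end_ m n : m != n -> (forall r, (m, r) \in H -> r = n) -> on x y (pos m) ->
    pos m = ps x \/ pos m = ps y.
  move=> nmn only hm.
  have [e|nx] := eqVneq (pos m) (ps x); first by left.
  have [e|ny] := eqVneq (pos m) (ps y); first by right.
  have hm' : on y x (pos m) by rewrite onseg_sym.
  have [a [ma [s /andP[s0 _] Ea]]] := neighbor_towards xy hm ny.
  have [b [mb [t /andP[t0 _] Eb]]] := neighbor_towards yx hm' nx.
  have [k k0 K] := towards_posm xy hm ny s0 Ea.
  have [l l0 L] := towards_posm yx hm' nx t0 Eb.
  have e : a = b by rewrite (only _ ma) (only _ mb).
  move: L; rewrite -e K dvN => -[e1 e2].
  have := adj_nzv xy; rewrite /nzv => /orP[] /eqP[]; apply/eqP; move: e1 e2 => /= e1 e2.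
    have : (k + l) * (dv x y).1 == 0 by apply/eqP; rewrite mulrDl; move: e1; rewrite /=; lra.
    by rewrite mulf_eq0 gt_eqF ?addr_gt0.
  have : (k + l) * (dv x y).2 == 0 by apply/eqP; rewrite mulrDl; move: e2; rewrite /=; lra.
  by rewrite mulf_eq0 gt_eqF ?addr_gt0.
have deg1 m n a b : m != n -> (forall r, (m, r) \in H -> r = n) -> pos m = ps a -> adj a b ->
    on a b (pos n) -> forall z, adj a z -> z = b.
  move=> nmn only Em ab hn z az.
  have nz : pos m != ps z by rewrite Em; apply/eqP => /ps_inj e; rewrite e adjI in az.
  have hm : on a z (pos m) by rewrite Em onseg_l.
  have [r [mr [s /andP[s0 s1] Er]]] := neighbor_towards az hm nz.
  have rn' := only _ mr; subst r.
  have hn' : on a z (pos n) by rewrite Er; apply: onseg_convex; rewrite ?onseg_r ?s1 ?andbT // ltW.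
  have npn : pos m != pos n by rewrite (inj_eq pos_inj).
  have hm2 : on a b (pos m) by rewrite Em onseg_l.
  have E' := edge_unique az ab npn hm hm2 hn' hn.
  by case: (adj_set az E') => -[// e1 e2]; rewrite e1 adjI in ab.
have nqp : q != p by rewrite eq_sym.
have fin a b : adj a b -> pos p = ps a -> pos q = ps b -> False.
  move=> ab Ep Eq; have ba : adj b a by rewrite adjC.
  case: (no_K2 ab) => -[z az zb].
    case/eqP: zb; apply: (deg1 p q a b npq only_p Ep ab) => //.
    by rewrite Eq onseg_r.
  case/eqP: zb; apply: (deg1 q p b a nqp only_q Eq ba) => //.
  by rewrite Ep onseg_r.
case: (end_ p q npq only_p hp) => Ep; case: (end_ q p nqp only_q hq) => Eq.
- by case/eqP: npq; apply: pos_inj; rewrite Ep Eq.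
- exact: fin xy Ep Eq.
- exact: fin yx Ep Eq.
- by case/eqP: npq; apply: pos_inj; rewrite Ep Eq.
Qed.

Lemma card_H : #|H| = (#|[set d in H | d.1 \in V]| + 4 * #|~: V|)%N.
Proof.
rewrite -(cardsID [set d | d.1 \in V] H); congr (_ + _)%N.
  by apply: eq_card => d; rewrite !inE andbC.
rewrite -sum1_card (eq_bigl (fun d => (d.1 \notin V) && ((d.1, d.2) \in H))); last first.
  by case=> p q; rewrite in_setD in_set.
rewrite -(pair_big_dep (fun p => p \notin V) (fun p q => (p, q) \in H) (fun _ _ => 1%N)) /=.
rewrite mulnC -sum_nat_const; apply: congr_big => // p; rewrite ?in_setC // => pV.
by rewrite -(H_degree pV) -sum1_card; apply: eq_bigl => q; rewrite [in RHS]inE.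
Qed.

(** A dart [(x, y)] is sent to the first piece of its edge at [x]; by [edge_unique] a piece belongs
    to one edge only. *)
Lemma card_darts : (#|[set e : V0 * V0 | adj e.1 e.2]| <= #|[set d in H | d.1 \in V]|)%N.
Proof.
have [->|/set0Pn[e0]] := eqVneq [set e : V0 * V0 | adj e.1 e.2] set0; first by rewrite cards0.
case: e0 => x0 y0; rewrite inE /= => xy0.
have [p0 _] := vertex_pt xy0.
pose good (e : V0 * V0) (d : P * P) := [&& d \in H, d.1 \in V, pos d.1 == ps e.1 & on e.1 e.2 (pos d.2)].
pose f e := odflt (p0, p0) [pick d | good e d].
have fP e : adj e.1 e.2 -> good e (f e).
  case: e => x y /= xy; rewrite /f; case: pickP => //= none.
  have [p Ep] := vertex_pt xy.
  have ny : pos p != ps y by rewrite Ep; apply/eqP => /ps_inj e; rewrite e adjI in xy.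
  have hp : on x y (pos p) by rewrite Ep onseg_l.
  have [q [pq [s /andP[s0 s1] Eq]]] := neighbor_towards xy hp ny.
  have := none (p, q); rewrite /good /= pq Ep eqxx /= Eq onseg_convex ?onseg_r ?s1 ?ltW // andbT.
  by move/negP; case; apply/VP; exists x, y.
rewrite -(card_in_imset (f := f)).
  apply/subset_leq_card/subsetP => _ /imsetP[e + ->]; rewrite inE => /fP/and4P[h1 h2 _ _].
  by rewrite [X in _ \in X]/= in_set h1.
move=> [x y] [z w]; rewrite !inE /= => xy zw E.
have /and4P[h1 _ /eqP /= h2 h3] := fP (x, y) xy; have := fP (z, w) zw.
rewrite -E => /and4P[_ _ /eqP /= h4 h5].
have exz : x = z by apply: ps_inj; rewrite -h2 -h4.
subst z; move: h1 h2 h3 h5; case: (f (x, y)) => p q /= pq Ep hq hq'.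
have npq : pos p != pos q by rewrite (inj_eq pos_inj) (plane_neq plane_H pq).
have hp u : on x u (pos p) by rewrite Ep onseg_l.
have Es := edge_unique xy zw npq (hp y) (hp w) hq hq'.
by case: (adj_set xy Es) => -[// e1 e2]; [rewrite e2 | rewrite -e1 adjI in zw].
Qed.

Lemma card_V : (#|V| <= #|[set x | [exists y, adj x y]]|)%N.
Proof.
pose pt x := [pick p | pos p == ps x].
have Si : injective (@Some P) by move=> a b [].
rewrite -(card_imset _ Si).
apply: leq_trans (leq_imset_card pt _); apply/subset_leq_card/subsetP => _ /imsetP[p /VP[x [y [xy E]]] ->].
apply/imsetP; exists x; first by rewrite inE; apply/existsP; exists y.
rewrite /pt; case: pickP => [q /eqP Eq|/(_ p)]; last by rewrite E eqxx.
by congr Some; apply: pos_inj; rewrite Eq E.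
Qed.

(** Let h be the number of darts of [H] leaving [V]. Six times Euler's inequality added to
    [faces_bound] gives [3 * #|H| + 24 <= 2 h + 12 * #|P|]; by [card_H] the crossings cancel,
    leaving [h + 24 <= 12 * #|V|]. *)
Theorem planarization_bound : (exists x y, adj x y) ->
  (#|[set e : V0 * V0 | adj e.1 e.2]| + 24 <= 12 * #|[set x | [exists y, adj x y]]|)%N.
Proof.
case=> x [y xy]; have [p0 _] := vertex_pt xy.
have eul := euler_inequality pos_inj plane_H p0 H_no_isolated.
have fb := faces_bound plane_H H_opposite H_corner_pos H_no_digon
  (no_tri_pent pos_inj plane_H alpha_lo alpha_hi H_corner_pos H_corner_wide).
have eC := cardsC V; move: card_H card_darts card_V eul fb eC.
move: #|[set d in H | d.1 \in V]| #|H| #|V| #|~: V| #|P| (nfaces plane_H) #|{: P * P}|.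
move: #|[set e : V0 * V0 | adj e.1 e.2]| #|[set x0 | [exists y0, adj x0 y0]]|.
by move=> a b c d e f g h i; lia.
Qed.

End Planarization.

(** * Row vectors as pairs of coordinates *)

Section Coordinates.
Variable R : realType.
Implicit Types (a b c d u : 'rV[R]_2).

Definition coord u : R * R := (u 0 0, u 0 1).

Lemma coord_inj : injective coord.
Proof.
move=> u v [e0 e1]; apply/rowP => i.
have [-> | ->] : i = 0 \/ i = 1 by case: i => [[|[|]]] // hi; [left | right]; apply/val_inj.
  exact: e0.
exact: e1.
Qed.

Lemma dot_coord u v : dot u v = dotp (coord u) (coord v).
Proof.
rewrite /dot big_ord_recl big_ord1 /dotp /coord /=.
by rewrite (_ : lift ord0 ord0 = 1) //; apply: val_inj.
Qed.

Lemma coordB a b : coord (b - a) = vec (coord a) (coord b).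
Proof. by rewrite /coord /vec !mxE. Qed.

Lemma onseg_segment a b s : onseg (coord a) (coord b) s ->
  exists2 q, segment a b q & coord q = s.
Proof.
case/onseg_at => t t01 ->; exists ((1 - t) *: a + t *: b); first by exists t.
by rewrite /coord /at_ /= !mxE; congr pair; ring.
Qed.

(** Cosine decreases on [0, pi], so an angle in [alpha, pi - alpha] has cosine at most [cos alpha]
    in absolute value. *)
Lemma segment_angle_wide alpha a b c d : 0 <= alpha <= pi / 2 -> a != b -> c != d ->
  alpha <= segment_angle a b c d ->
  wide (cos alpha) (vec (coord a) (coord b)) (vec (coord c) (coord d)).
Proof.
move=> /andP[a0 a1] ab cd; have pi0 := pi_gt0 R.
rewrite /segment_angle /vangle /enorm !dot_coord !coordB.
have nz (x y : 'rV[R]_2) : x != y -> 0 < dotp (vec (coord x) (coord y)) (vec (coord x) (coord y)).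
  move=> xy; apply: dotp_gt0; apply: contraNT xy => /vec0/coord_inj ->.
  exact: eqxx.
have := nz _ _ ab; have := nz _ _ cd.
move: (vec (coord a) (coord b)) (vec (coord c) (coord d)) => u v v0 u0.
rewrite -(sqrtrM _ (ltW u0)) /wide; set n := (X in dotp u v / X); set r := dotp u v / n => h.
have n0 : 0 < n by rewrite sqrtr_gt0 mulr_gt0.
have n2 : n ^+ 2 = dotp u u * dotp v v by rewrite sqr_sqrtr // mulr_ge0 // ltW.
have r1 : -1 <= r <= 1.
  rewrite -ler_norml -(@ler_pXn2r _ 2) ?nnegrE // real_normK ?num_real //.
  rewrite expr1n /r expr_div_n n2 ler_pdivrMr ?mulr_gt0 // mul1r.
  by rewrite -subr_ge0 -lagrange sqr_ge0.
have ct : cos (acos r) = r by rewrite acosK // in_itv.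
have t0 := acos_ge0 r1; have tpi := acos_lepi r1.
have [h1 h2] : alpha <= acos r /\ alpha <= pi - acos r.
  by move: h; rewrite le_min => /andP[].
have c1 : r <= cos alpha.
  rewrite leNgt; apply/negP => lt; move: lt; rewrite -ct ltr_cos ?in_itv /= ?t0 ?a0 //.
    by rewrite ltNge h1.
  by lra.
have c2 : - cos alpha <= r.
  have -> : - cos alpha = cos (pi - alpha) by rewrite cosB cospi sinpi mul0r addr0 mulN1r.
  rewrite leNgt; apply/negP => lt; move: lt; rewrite -ct ltr_cos ?in_itv /= ?t0 //.
    by rewrite ltNge; apply/negP; rewrite negbK; lra.
  by apply/andP; split; lra.
have -> : dotp u v = r * n by rewrite /r mulfVK // gt_eqF.
rewrite exprMn n2 ler_pM2r ?mulr_gt0 // -subr_ge0 subr_sqr mulr_ge0 //.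
  by rewrite subr_ge0.
by move: c2; clear; lra.
Qed.

End Coordinates.

(** * The finite point set of the planarization *)

Section Crossings.
Variables (R : realType) (V0 : finType) (adj : rel V0) (ps : V0 -> R * R).
Hypothesis adjC : symmetric adj.
Hypothesis adjI : irreflexive adj.
Hypothesis ps_inj : injective ps.
Variable alpha : R.
Hypothesis alpha_lo : 2 * pi / 5 < alpha.
Hypothesis alpha_hi : alpha <= pi / 2.

Local Notation on x y s := (onseg (ps x) (ps y) s).

Hypothesis crossing_wide : forall x y z w s, adj x y -> adj z w ->
  [set x; y] != [set z; w] -> on x y s -> on z w s ->
  (forall v, v \in [set x; y] -> v \in [set z; w] -> s <> ps v) ->
  wide (cos alpha) (vec (ps x) (ps y)) (vec (ps z) (ps w)).
Hypothesis no_K2 : forall x y, adj x y ->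
  (exists2 z, adj x z & z != y) \/ (exists2 z, adj y z & z != x).

(* For parallel lines the division by zero makes this the point x. *)
Definition line_meet (x y z w : R * R) :=
  at_ x y (orient z w x / (orient z w x - orient z w y)).

Lemma line_meetE (x y z w s : R * R) : cross (vec x y) (vec z w) != 0 ->
  onseg x y s -> onseg z w s -> s = line_meet x y z w.
Proof.
move=> c0 /onseg_at[t _ ->] h; congr at_.
have e : (1 - t) * orient z w x + t * orient z w y = 0.
  have <- : orient z w (at_ x y t) = (1 - t) * orient z w x + t * orient z w y.
    by rewrite /orient /cross /vec /at_ /=; ring.
  by apply: onseg_orient h; rewrite ?onseg_l ?onseg_r.
have d : orient z w x - orient z w y != 0.
  have -> : orient z w x - orient z w y = cross (vec x y) (vec z w).
    by rewrite /orient /cross /vec /=; ring.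
  by [].
apply: (mulIf d); rewrite mulfVK //.
by move: e; move: (orient z w x) (orient z w y) => A B e; lra.
Qed.

Let pts : seq (R * R) :=
  [seq ps x | x <- enum V0 & [exists y, adj x y]] ++
  [seq line_meet (ps e.1.1) (ps e.1.2) (ps e.2.1) (ps e.2.2) |
     e <- enum {: (V0 * V0) * (V0 * V0)} &
     let q := line_meet (ps e.1.1) (ps e.1.2) (ps e.2.1) (ps e.2.2) in
     [&& adj e.1.1 e.1.2, adj e.2.1 e.2.2, [set e.1.1; e.1.2] != [set e.2.1; e.2.2],
         on e.1.1 e.1.2 q & on e.2.1 e.2.2 q]].

Let pt_mem s : s \in pts -> exists p : seq_sub pts, ssval p = s.
Proof. by move=> h; exists (SeqSub h). Qed.

Lemma darts_bound : (exists x y, adj x y) ->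
  (#|[set e : V0 * V0 | adj e.1 e.2]| + 24 <= 12 * #|[set x | [exists y, adj x y]]|)%N.
Proof.
have vmem x y : adj x y -> ps x \in pts.
  move=> xy; rewrite mem_cat; apply/orP; left; apply/map_f.
  by rewrite mem_filter mem_enum andbT; apply/existsP; exists y.
apply: (@planarization_bound R V0 adj ps adjC adjI ps_inj alpha alpha_lo alpha_hi crossing_wide no_K2
  (seq_sub pts) (@ssval _ pts)).
- exact: val_inj.
- by move=> x y xy; apply: pt_mem; apply: vmem xy.
- move=> p; have := ssvalP p; rewrite mem_cat => /orP[] /mapP[].
    move=> x; rewrite mem_filter => /andP[/existsP[y xy] _] e.
    by left; exists x, y.
  case=> [[x y] [z w]]; rewrite mem_filter => /andP[/and5P[/= h1 h2 h3 h4 h5] _] e.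
  by right; exists x, y, z, w; rewrite e.
move=> x y z w s xy zw ne h1 h2; apply: pt_mem.
(* A shared endpoint is already among the vertices; any other common point is a crossing of
   nonparallel lines and thus their [line_meet]. *)
have [/existsP[v /and3P[v1 v2 /eqP ->]]|/existsPn hv] :=
  boolP [exists v, [&& v \in [set x; y], v \in [set z; w] & s == ps v]].
  move: v1; rewrite !inE => /orP[] /eqP ->; first exact: vmem xy.
  by apply: (@vmem y x); rewrite adjC.
have nz u v : adj u v -> nzv (vec (ps u) (ps v)).
  by move=> uv; apply/negPn/negP => /vec0/ps_inj e; rewrite e adjI in uv.
have cos1 : 0 <= cos alpha < 1.
  have c2 := cos_lt_half alpha_lo alpha_hi.
  rewrite (lt_trans c2) ?invf_lt1 ?ltr1n // andbT cos_ge0_pihalf // alpha_hi andbT.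
  by have := pi_gt0 R; have := alpha_lo; lra.
have wd : wide (cos alpha) (vec (ps x) (ps y)) (vec (ps z) (ps w)).
  apply: (crossing_wide (s := s)) => // v v1 v2 /eqP e.
  by have := hv v; rewrite v1 v2 e.
have sE := line_meetE (wide_cross cos1 (nz _ _ xy) (nz _ _ zw) wd) h1 h2.
rewrite mem_cat; apply/orP; right; apply/mapP; exists ((x, y), (z, w)) => //.
by rewrite mem_filter mem_enum andbT /= -sE xy zw ne h1 h2.
Qed.

End Crossings.

(** * Removal of isolated edges and the final count *)

Section Main.
Variables (R : realType) (G : geometric_graph R) (alpha : R).
Hypothesis alpha_lo : 2 * pi / 5 < alpha.
Hypothesis alpha_hi : alpha <= pi / 2.
Hypothesis angleG : angle_crossing G alpha.

Local Notation V0 := (vertex G).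
Local Notation adj := (@adj R G).
Let ps (x : V0) := coord (pos x).

Let ps_inj : injective ps.
Proof. by move=> x y /coord_inj/pos_inj. Qed.

Let crossing_wide x y z w s : adj x y -> adj z w ->
  [set x; y] != [set z; w] -> onseg (ps x) (ps y) s -> onseg (ps z) (ps w) s ->
  (forall v, v \in [set x; y] -> v \in [set z; w] -> s <> ps v) ->
  wide (cos alpha) (vec (ps x) (ps y)) (vec (ps z) (ps w)).
Proof.
move=> xy zw ne /onseg_segment[q q1 qs] /onseg_segment[q' q1' qs'] nv.
have eq_q : q' = q by apply: coord_inj; rewrite qs qs'.
have neq (u v : V0) : adj u v -> pos u != pos v.
  by move=> uv; apply/eqP => /pos_inj e; have := adj_irrefl u; rewrite {2}e uv.
apply: segment_angle_wide; rewrite ?neq //.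
  by rewrite alpha_hi andbT; have := pi_gt0 R; have := alpha_lo; lra.
apply: angleG; split=> //; exists q; split=> //; first by rewrite -eq_q.
by case=> v []; rewrite inE => /andP[v1 v2] e; apply: (nv v) => //; rewrite -qs e.
Qed.

Definition isolated_edge (x y : V0) :=
  [&& adj x y, [forall z, adj x z ==> (z == y)] & [forall z, adj y z ==> (z == x)]].

Let adj' x y := adj x y && ~~ isolated_edge x y.

Let isolated_edgeC x y : isolated_edge x y = isolated_edge y x.
Proof. by rewrite /isolated_edge adj_sym; congr (_ && _); rewrite andbC. Qed.

Lemma darts_bound_graph : (3 <= #|V0|)%N ->
  (#|[set e : V0 * V0 | adj e.1 e.2]| + 24 <= 12 * #|V0|)%N.
Proof.
move=> n3; pose K := [set x | [exists y, isolated_edge x y]].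
pose D := [set e : V0 * V0 | adj e.1 e.2]; pose D' := [set e : V0 * V0 | adj' e.1 e.2].
pose N := [set x | [exists y, adj' x y]].
have adj'C : symmetric adj' by move=> x y; rewrite /adj' adj_sym isolated_edgeC.
have adj'I : irreflexive adj' by move=> x; rewrite /adj' adj_irrefl.
have only x y z : isolated_edge x y -> adj x z -> z = y.
  by case/and3P => _ /forallP/(_ z)/implyP h _ /h/eqP.
(* Isolated edges share no end with other edges, so deleting them isolates no further edge. *)
have noK x y : adj' x y -> (exists2 z, adj' x z & z != y) \/ (exists2 z, adj' y z & z != x).
  case/andP=> xy; rewrite negb_and xy /= negb_and => /orP[] /forallPn[z]; rewrite negb_imply => /andP[h1 h2].
    left; exists z => //; rewrite /adj' h1; apply/negP => /only/(_ xy) e.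
    by rewrite e eqxx in h2.
  right; exists z => //; rewrite /adj' h1; apply/negP => /only.
  by rewrite adj_sym in xy; move/(_ _ xy) => e; rewrite e eqxx in h2.
have cD : (#|D| <= #|D'| + #|K|)%N.
  rewrite -(cardsID D' D) leq_add ?subset_leq_card ?subsetIr //.
  have inj : {in D :\: D' &, injective (fun e : V0 * V0 => e.1)}.
    move=> [x y] [z w]; rewrite !inE /adj' /= => /andP[h1 xy] /andP[h2 zw] e; subst z.
    by rewrite xy /= negbK in h1; rewrite (only _ _ _ h1 zw).
  rewrite -(card_in_imset inj); apply/subset_leq_card/subsetP => _ /imsetP[[x y] + ->].
  rewrite !inE /adj' /= => /andP[h1 xy]; apply/existsP; exists y.
  by rewrite xy /= negbK in h1.
have cN : (#|N| + #|K| <= #|V0|)%N.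
  have : N :&: K = set0.
    apply/setP => x; rewrite !inE; apply/negP => /andP[/existsP[y /andP[xy nk]] /existsP[z k]].
    by case/negP: nk; rewrite (only _ _ _ k xy).
  by have := cardsUI N K => + e; rewrite e cards0 addn0 => <-; apply: max_card.
(* If all edges are isolated, there are at most n darts, and [n + 24 <= 12 * n] holds from n = 3 on;
   for n = 2 a single edge would violate the bound. *)
have [D0|/set0Pn[[x y]]] := eqVneq D' set0.
  by move: cD cN; rewrite D0 cards0 -/D; lia.
rewrite inE /= => xy.
have := @darts_bound R V0 adj' ps adj'C adj'I ps_inj alpha alpha_lo alpha_hi _ noK.
have h : exists x y, adj' x y by exists x, y.
move/(_ _ h) => H; have : (#|D'| + 24 <= 12 * #|N|)%N.
  apply: H => x1 y1 z1 w1 s /andP[h1 _] /andP[h2 _]; exact: crossing_wide.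
move: cD cN; rewrite -/D; move: #|D| #|D'| #|N| #|K| #|V0| => a b c d e.
by lia.
Qed.

Lemma card_edges : (2 * #|edges G| <= #|[set e : V0 * V0 | adj e.1 e.2]|)%N.
Proof.
rewrite -[X in (_ <= X)%N]sum1_card (partition_big_imset (fun e : V0 * V0 => [set e.1; e.2])) /=.
rewrite mulnC -sum_nat_const; apply: leq_sum => _ /imsetP[[x y] + ->].
rewrite inE /= => xy; have nxy : x != y by apply: contraTneq xy => ->; rewrite adj_irrefl.
rewrite (bigD1 (x, y)) /=; last by rewrite inE /= xy eqxx.
rewrite (bigD1 (y, x)) //= inE /= adj_sym xy setUC eqxx xpair_eqE.
by rewrite negb_and eq_sym nxy.
Qed.

End Main.

Theorem theorem6 (R : realType) (alpha : R) (halpha : 2 * pi / 5 < alpha)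
    (G : geometric_graph R) (n : nat) (hn : #|vertex G| = n) (hn3 : (3 <= n)%N)
    (hG : angle_crossing G alpha) :
  (#|edges G| <= 6 * n - 12)%N.
Proof.
subst n; have pi0 := pi_gt0 R.
(* Cutting alpha at pi / 2 weakens the hypothesis and keeps [cos alpha] nonnegative, which [wide]
   needs because it squares the cosine. *)
have lo : 2 * pi / 5 < Num.min alpha (pi / 2) by rewrite lt_min halpha /=; lra.
have hi : Num.min alpha (pi / 2) <= pi / 2 by rewrite ge_min lexx orbT.
have hG' : angle_crossing G (Num.min alpha (pi / 2)).
  by move=> x y z w /hG; apply: le_trans; rewrite ge_min lexx.
have := darts_bound_graph lo hi hG' hn3; have := card_edges G; lia.
Qed.
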